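(* Let $\Psi\subseteq\Phi^+$. Then $\Psi$ is compatible (with the Worpitzky partition) if and only if for every positive integer $q$, $$\chi^{\mathrm{quasi}}_{\Psi}(q)=(E_\Psi(S)\,\mathrm{L}_{\overline{A^\circ}})(q).$$
   Context: Let $V=\mathbb{R}^\ell$ with the standard inner product $(\cdot,\cdot)$, $\Phi$ an irreducible crystallographic root system in $V$, $\Phi^+$ a positive system with simple roots $\alpha_1,\dots,\alpha_\ell$, and $W$ the Weyl group. Write the highest root as $\tilde\alpha=\sum_{i=1}^\ell c_i\alpha_i$ ($c_i\in\mathbb{Z}_{>0}$), set $\alpha_0:=-\tilde\alpha$, $c_0:=1$. Let $\mathrm{h}$ be the Coxeter number (equal to $c_0+c_1+\dots+c_\ell$). The coweight lattice is $Z(\Phi^\vee)=\{x\in V\mid (\alpha_i,x)\in\mathbb{Z},\,1\le i\le \ell\}$, the coroot lattice $Q(\Phi^\vee)$ is spanned by $\alpha_i^\vee=2\alpha_i/(\alpha_i,\alpha_i)$, and $f=[Z(\Phi^\vee):Q(\Phi^\vee)]$ is the index of connection. For $\alpha\in\Phi$, $m\in\mathbb{Z}$ put $H_{\alpha,m}=\{x\in V\mid(\alpha,x)=m\}$. Alcoves are the connected components of $V\setminus\bigcup_{\alpha\in\Phi^+,m\in\mathbb{Z}}H_{\alpha,m}$; the fundamental alcove is $A^\circ=\{x\mid(\alpha_i,x)>0\ (1\le i\le\ell),\ (\alpha_0,x)>-1\}$. $\mathrm{L}_{\overline{A^\circ}}(q)=\#(q\overline{A^\circ}\cap Z(\Phi^\vee))$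 is the Ehrhart quasi-polynomial of the closed fundamental alcove with respect to $Z(\Phi^\vee)$, regarded as a quasi-polynomial function on all of $\mathbb{Z}$. For $\Psi\subseteq\Phi^+$ let $\Psi^c=\Phi^+\setminus\Psi$; for $w\in W$ define $\mathrm{dsc}_\Psi(w)=\sum_{0\le i\le\ell,\ w(\alpha_i)\in-\Psi^c}c_i$, and the $\mathcal{A}$-Eulerian polynomial $E_\Psi(t)=\frac1f\sum_{w\in W}t^{\mathrm{h}-\mathrm{dsc}_\Psi(w)}$. For a polynomial $P(S)=\sum_k a_kS^k$ and a function $g:\mathbb{Z}\to\mathbb{C}$, the shift operator is $(P(S)g)(t)=\sum_k a_k g(t-k)$. The characteristic quasi-polynomial (w.r.t. the root lattice): for $q\in\mathbb{Z}_{>0}$, $\chi^{\mathrm{quasi}}_\Psi(q)=\#\{z\in(\mathbb{Z}/q\mathbb{Z})^\ell \mid \sum_i a_iz_i\not\equiv0 \bmod q \text{ for every }\alpha=\sum_i a_i\alpha_i\in\Psi\}$. Worpitzky partition: let $P^\diamondsuit=\{x\in V\mid 0<(\alpha_i,x)\le1,\,1\le i\le\ell\}$. The alcoves contained in $P^\diamondsuit$ are $A_1^\circ,\dots,A_N^\circ$ ($N=\#W/f$). Each is written uniquely as $A_i^\circ=\{x\mid (\alpha,x)>k_\alpha\ (\alpha\in I),\ (\beta,x)<k_\beta\ (\beta\in J)\}$ with $I,J\subseteq\Phi^+$, $\#(I\sqcup J)=\ell+1$, $k_\alpha\in\mathbb{Z}_{\ge0}$, $k_\beta\in\mathbb{Z}_{>0}$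 (the hyperplanes $H_{\alpha,k_\alpha},H_{\beta,k_\beta}$ support the facets of $\overline{A_i^\circ}$). Its partial closure is $A_i^\diamondsuit=\{x\mid (\alpha,x)>k_\alpha\ (\alpha\in I),\ (\beta,x)\le k_\beta\ (\beta\in J)\}$; then $P^\diamondsuit=\bigsqcup_i A_i^\diamondsuit$. A facet of $A_i^\diamondsuit$ means a set $A_i^\diamondsuit\cap H$, nonempty, where $H$ supports a facet of $\overline{A_i^\circ}$. Compatibility: $\Psi$ is compatible if for every $i$ and every $\alpha\in\Psi$, $m\in\mathbb{Z}$, the set $A_i^\diamondsuit\cap H_{\alpha,m}$ is either empty or contained in $A_i^\diamondsuit\cap H_{\beta,m'}$ for some $\beta\in\Psi$, $m'\in\mathbb{Z}$ such that $A_i^\diamondsuit\cap H_{\beta,m'}$ is a facet of $A_i^\diamondsuit$. *)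

(* Defs.v *)
From HB Require Import structures.
From mathcomp Require Import all_boot all_order all_algebra finmap.
From mathcomp Require Import all_classical all_reals all_analysis.

Set Implicit Arguments.
Unset Strict Implicit.
Unset Printing Implicit Defensive.

Import Order.TTheory GRing.Theory Num.Theory.
Import numFieldNormedType.Exports.

Local Open Scope classical_set_scope.
Local Open Scope ring_scope.

(** Root systems in [V = 'rV[R]_l] with the standard inner product. *)

Definition dot (R : realType) (l : nat) (u v : 'rV[R]_l) : R :=
  \sum_(i < l) u 0 i * v 0 i.

Definition reflection (R : realType) (l : nat) (a v : 'rV[R]_l) : 'rV[R]_l :=
  v - (2 * dot v a / dot a a) *: a.

Record root_system (R : realType) (l : nat) (Phi : {fset 'rV[R]_l}) : Prop :=
  RootSystem {
    root_span : <<Phi>>%VS = fullv;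
    root_neq0 : 0 \notin Phi;
    root_reduced : forall (a : 'rV[R]_l) (k : R),
      a \in Phi -> k *: a \in Phi -> k = 1 \/ k = -1;
    root_reflection : forall a b : 'rV[R]_l,
      a \in Phi -> b \in Phi -> reflection a b \in Phi;
    root_crystallographic : forall a b : 'rV[R]_l,
      a \in Phi -> b \in Phi -> 2 * dot b a / dot a a \is a Num.int }.

Definition irreducible_roots (R : realType) (l : nat) (Phi : {fset 'rV[R]_l}) : Prop :=
  Phi <> fset0 /\
  forall Phi1 Phi2 : {fset 'rV[R]_l},
    Phi = (Phi1 `|` Phi2)%fset ->
    (forall a b, a \in Phi1 -> b \in Phi2 -> dot a b = 0) ->
    Phi1 = fset0 \/ Phi2 = fset0.

Definition int_comb (R : realType) (l : nat) (alpha : 'I_l -> 'rV[R]_l)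
    (n : 'I_l -> int) : 'rV[R]_l :=
  \sum_(i < l) (n i)%:~R *: alpha i.

Definition nat_comb (R : realType) (l : nat) (alpha : 'I_l -> 'rV[R]_l)
    (n : 'I_l -> nat) : 'rV[R]_l :=
  int_comb alpha (fun i => (n i)%:Z).

Definition simple_system (R : realType) (l : nat) (Phi : {fset 'rV[R]_l})
    (alpha : 'I_l -> 'rV[R]_l) : Prop :=
  [/\ basis_of fullv [seq alpha i | i <- enum 'I_l],
      forall i, alpha i \in Phi
    & forall b, b \in Phi ->
        exists n : 'I_l -> nat, b = nat_comb alpha n \/ b = - nat_comb alpha n].

Definition positive_roots (R : realType) (l : nat) (Phi : {fset 'rV[R]_l})
    (alpha : 'I_l -> 'rV[R]_l) : {fset 'rV[R]_l} :=
  [fset b in Phi | `[< exists n : 'I_l -> nat, b = nat_comb alpha n >]]%fset.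

(** [c] lists the coefficients of the highest root on the simple roots. *)
Definition highest_root_coefs (R : realType) (l : nat) (Phi : {fset 'rV[R]_l})
    (alpha : 'I_l -> 'rV[R]_l) (c : 'I_l -> nat) : Prop :=
  nat_comb alpha c \in Phi /\
  forall b, b \in Phi ->
    exists n : 'I_l -> nat, nat_comb alpha c - b = nat_comb alpha n.

(** The indices [0 <= i <= l] are [ord0] and [lift ord0 i] in ['I_l.+1]. *)
Definition ext_simple (R : realType) (l : nat) (alpha : 'I_l -> 'rV[R]_l)
    (c : 'I_l -> nat) (i : 'I_l.+1) : 'rV[R]_l :=
  oapp alpha (- nat_comb alpha c) (unlift ord0 i).

Definition ext_coef (l : nat) (c : 'I_l -> nat) (i : 'I_l.+1) : nat :=
  oapp c 1%N (unlift ord0 i).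

(** The Coxeter number, as [1 + c_1 + ... + c_l]. *)
Definition coxeter_number (l : nat) (c : 'I_l -> nat) : nat :=
  (\sum_(i < l.+1) ext_coef c i)%N.

(** Closure under inverses is automatic, since reflections are involutions. *)
Inductive weyl_group (R : realType) (l : nat) (Phi : {fset 'rV[R]_l}) :
    set ('rV[R]_l -> 'rV[R]_l) :=
| weyl_id : weyl_group Phi id
| weyl_mul a w : a \in Phi -> weyl_group Phi w ->
    weyl_group Phi (reflection a \o w).

Definition coweight_lattice (R : realType) (l : nat)
    (alpha : 'I_l -> 'rV[R]_l) : set 'rV[R]_l :=
  [set x | forall i, dot (alpha i) x \is a Num.int].

Definition coroot (R : realType) (l : nat) (a : 'rV[R]_l) : 'rV[R]_l :=
  (2 / dot a a) *: a.

Definition coroot_lattice (R : realType) (l : nat)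
    (alpha : 'I_l -> 'rV[R]_l) : set 'rV[R]_l :=
  range (int_comb (fun i => coroot (alpha i))).

Definition set_card (T : choiceType) (A : set T) : nat := #|` fset_set A|.

(** The number of cosets [x + Q], [x \in Z]. *)
Definition connection_index (R : realType) (l : nat)
    (alpha : 'I_l -> 'rV[R]_l) : nat :=
  set_card [set [set x + y | y in coroot_lattice alpha]
               | x in coweight_lattice alpha].

(** Affine hyperplanes and alcoves. *)

Definition hyperplane (R : realType) (l : nat) (a : 'rV[R]_l) (m : int) :
    set 'rV[R]_l :=
  [set x | dot a x = m%:~R].

Definition affine_complement (R : realType) (l : nat) (Phi : {fset 'rV[R]_l})
    (alpha : 'I_l -> 'rV[R]_l) : set 'rV[R]_l :=
  ~` \bigcup_(a in [set` positive_roots Phi alpha])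
       \bigcup_(m in [set: int]) hyperplane a m.

Definition is_alcove (R : realType) (l : nat) (Phi : {fset 'rV[R]_l})
    (alpha : 'I_l -> 'rV[R]_l) (A : set 'rV[R]_l) : Prop :=
  exists2 x, affine_complement Phi alpha x
           & A = connected_component (affine_complement Phi alpha) x.

Definition fundamental_alcove (R : realType) (l : nat)
    (alpha : 'I_l -> 'rV[R]_l) (c : 'I_l -> nat) : set 'rV[R]_l :=
  [set x | (forall i, 0 < dot (alpha i) x)
        /\ -1 < dot (ext_simple alpha c ord0) x].

(** Quasi-polynomials, the Ehrhart quasi-polynomial and the shift operator. *)

Definition quasi_polynomial (K : nzRingType) (g : int -> K) : Prop :=
  exists2 n : nat, (0 < n)%N &
    exists p : int -> {poly K},
      forall t : int, g t = (p (t %% n%:Z)%Z).[t%:~R].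

Definition lattice_count (R : realType) (l : nat)
    (alpha : 'I_l -> 'rV[R]_l) (c : 'I_l -> nat) (q : nat) : nat :=
  set_card ([set q%:R *: x | x in closure (fundamental_alcove alpha c)]
            `&` coweight_lattice alpha).

(** The quasi-polynomial on all of [int] that counts lattice points at positive
    arguments; a quasi-polynomial is determined by its values there. *)
Definition ehrhart (R : realType) (l : nat)
    (alpha : 'I_l -> 'rV[R]_l) (c : 'I_l -> nat) : int -> rat :=
  xget (fun=> 0) [set g : int -> rat |
    quasi_polynomial g /\
    forall q : nat, (0 < q)%N -> g q%:Z = (lattice_count alpha c q)%:R].

Definition shift_op (K : nzRingType) (P : {poly K}) (g : int -> K) (t : int) : K :=
  \sum_(k < size P) P`_k * g (t - k%:Z).

(** The A-Eulerian polynomial. *)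

Definition dsc (R : realType) (l : nat) (Phi : {fset 'rV[R]_l})
    (alpha : 'I_l -> 'rV[R]_l) (c : 'I_l -> nat) (Psi : {fset 'rV[R]_l})
    (w : 'rV[R]_l -> 'rV[R]_l) : nat :=
  (\sum_(i < l.+1 |
         (- w (ext_simple alpha c i)) \in (positive_roots Phi alpha `\` Psi)%fset)
     ext_coef c i)%N.

Definition eulerian (R : realType) (l : nat) (Phi : {fset 'rV[R]_l})
    (alpha : 'I_l -> 'rV[R]_l) (c : 'I_l -> nat) (Psi : {fset 'rV[R]_l}) :
    {poly rat} :=
  (connection_index alpha)%:R^-1 *:
    \sum_(w \in weyl_group Phi)
       ('X^(coxeter_number c - dsc Phi alpha c Psi w)%N : {poly rat}).

(** The characteristic quasi-polynomial; residue classes mod [q] are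
    represented by ['I_q], which is also right for [q = 1], unlike ['Z_q]. *)
Definition chi_quasi (R : realType) (l : nat) (alpha : 'I_l -> 'rV[R]_l)
    (Psi : {fset 'rV[R]_l}) (q : nat) : nat :=
  #|[pred z : {ffun 'I_l -> 'I_q} |
      `[< forall a : 'I_l -> int, int_comb alpha a \in Psi ->
            ~~ (q%:Z %| \sum_(i < l) a i * (z i)%:Z)%Z >]]|.

(** The Worpitzky partition and compatibility. *)

Definition worpitzky_box (R : realType) (l : nat)
    (alpha : 'I_l -> 'rV[R]_l) : set 'rV[R]_l :=
  [set x | forall i, 0 < dot (alpha i) x <= 1].

(** [#(I |_| J) = l + 1] is a tagged disjoint union, with separate levels on [I]
    and on [J]: in rank 1 the only positive root lies in both. *)
Record presentation (R : realType) (l : nat) (Phi : {fset 'rV[R]_l})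
    (alpha : 'I_l -> 'rV[R]_l) (A : set 'rV[R]_l)
    (I J : {fset 'rV[R]_l}) (kI kJ : 'rV[R]_l -> int) : Prop :=
  Presentation {
    pres_lower : (I `<=` positive_roots Phi alpha)%fset;
    pres_upper : (J `<=` positive_roots Phi alpha)%fset;
    pres_card : (#|` I| + #|` J| = l.+1)%N;
    pres_lower_level : forall a, a \in I -> 0 <= kI a;
    pres_upper_level : forall b, b \in J -> 0 < kJ b;
    pres_alcove : A = [set x | (forall a, a \in I -> (kI a)%:~R < dot a x)
                            /\ (forall b, b \in J -> dot b x < (kJ b)%:~R)] }.

Definition partial_closure (R : realType) (l : nat)
    (I J : {fset 'rV[R]_l}) (kI kJ : 'rV[R]_l -> int) : set 'rV[R]_l :=
  [set x | (forall a, a \in I -> (kI a)%:~R < dot a x)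
        /\ (forall b, b \in J -> dot b x <= (kJ b)%:~R)].

(** The hyperplanes supporting the facets of the closed alcove are those of the
    presentation. *)
Definition is_facet (R : realType) (l : nat)
    (I J : {fset 'rV[R]_l}) (kI kJ : 'rV[R]_l -> int) (F : set 'rV[R]_l) : Prop :=
  F !=set0 /\
  ((exists2 a, a \in I & F = partial_closure I J kI kJ `&` hyperplane a (kI a)) \/
   (exists2 b, b \in J & F = partial_closure I J kI kJ `&` hyperplane b (kJ b))).

Definition compatible (R : realType) (l : nat) (Phi : {fset 'rV[R]_l})
    (alpha : 'I_l -> 'rV[R]_l) (Psi : {fset 'rV[R]_l}) : Prop :=
  forall A : set 'rV[R]_l, is_alcove Phi alpha A -> A `<=` worpitzky_box alpha ->
  forall (I J : {fset 'rV[R]_l}) (kI kJ : 'rV[R]_l -> int),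
    presentation Phi alpha A I J kI kJ ->
  let D := partial_closure I J kI kJ in
  forall (a : 'rV[R]_l) (m : int), a \in Psi ->
    D `&` hyperplane a m = set0 \/
    exists (b : 'rV[R]_l) (m' : int),
      [/\ b \in Psi, D `&` hyperplane a m `<=` D `&` hyperplane b m'
        & is_facet I J kI kJ (D `&` hyperplane b m')].

(* Main.v *)
(** Multiply by the index of connection [f] and count pairs [(w, x)], where [w]
    is in the Weyl group and [x] ranges over the natural solutions of
    [c_0 x_0 + ... + c_l x_l = q], i.e. over the coweights in the closed alcove
    [q A].  Every residue class of coweights mod [q] is hit by exactly [f] pairs
    [(w, x)] lying in the partial closures of the alcoves [w A + g], because the
    affine Weyl group is simply transitive on alcoves and a point on several
    walls can be pushed slightly in the antidominant direction.  Hence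
    [f * chi_Psi q] counts the pairs for which moreover no root of [Psi] is
    divisible by [q] at [w x].  Such pairs satisfy [x_i > 0] unless [- w alpha_i]
    is in [Psi^c]; all the pairs with this last property are counted by
    [f * (E_Psi(S) L)(q)], because shifting the [x_i] that must be positive
    turns them into solutions for [q - h + dsc w] and because the Ehrhart
    quasi-polynomial vanishes strictly between [- h] and [0].  So the formula
    says that the inclusion between the two sets of pairs is an equality for
    every [q], and this is compatibility: the hyperplanes of roots of [Psi]
    through a point depend only on the face containing the point, so a face that
    violates compatibility contains a rational point, i.e. a pair [(w, x)] in the
    difference. *)

Require Import Defs.
From mathcomp Require Import all_boot all_order all_algebra finmap.
From mathcomp Require Import all_classical all_reals all_analysis.
From mathcomp Require Import zify ring lra.

Set Implicit Arguments.
Unset Strict Implicit.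
Unset Printing Implicit Defensive.

Import Order.TTheory GRing.Theory Num.Theory.
Import numFieldNormedType.Exports.

Local Open Scope classical_set_scope.
Local Open Scope ring_scope.

(** * Scalar products and reflections *)

(** Alcove geometry is reduced to arithmetic by the barycentric coordinates [lam i], whose sum
    weighted by the [c_i] is 1. Since the highest root dominates every root, each affine root is, up
    to sign, a natural combination of the [lam i]; walls, sides, galleries and faces are then read
    off from coefficients. Translations run over all coweights, because a residue class [z] modulo
    [q] is reached through [w x + q g = z] with a coweight [g]. After a shift by a representative,
    the alcoves [w A + g] with [g] in a fixed coset of the coroot lattice tile the space once; the
    factor [f] counts these cosets. Two notions are given only indirectly. [ehrhart] is a chosen
    quasi-polynomial, so an explicit one is built whose values at negative integers are visible: its
    pieces are binomials [(s + 1) ... (s + l) / l!] in a rescaled variable. Compatibility quantifies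
    over arbitrary presentations of an alcove, so a presentation must be shown to consist of exactly
    the walls, which is where the count [l + 1] enters. *)

Section DotProduct.
Variables (R : realType) (l : nat).
Implicit Types (u v w b x : 'rV[R]_l) (k : R).

Lemma dotC u v : dot u v = dot v u.
Proof. by apply: eq_bigr => i _; rewrite mulrC. Qed.

Lemma dotDl u v w : dot (u + v) w = dot u w + dot v w.
Proof. by rewrite -big_split; apply: eq_bigr => i _; rewrite mxE mulrDl. Qed.

Lemma dotZl k u v : dot (k *: u) v = k * dot u v.
Proof. by rewrite mulr_sumr; apply: eq_bigr => i _; rewrite mxE mulrA. Qed.

Lemma dot0l u : dot 0 u = 0.
Proof. by rewrite -(scale0r u) dotZl mul0r. Qed.

Lemma dotNl u v : dot (- u) v = - dot u v.
Proof. by rewrite -scaleN1r dotZl mulN1r. Qed.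

Lemma dotBl u v w : dot (u - v) w = dot u w - dot v w.
Proof. by rewrite dotDl dotNl. Qed.

Lemma dot_suml (I : Type) (r : seq I) (P : pred I) (F : I -> 'rV[R]_l) v :
  dot (\sum_(i <- r | P i) F i) v = \sum_(i <- r | P i) dot (F i) v.
Proof.
by apply: (big_morph (fun u => dot u v)) => [u w|]; rewrite ?dotDl ?dot0l.
Qed.

Lemma dotDr u v w : dot w (u + v) = dot w u + dot w v.
Proof. by rewrite !(dotC w) dotDl. Qed.

Lemma dotZr k u v : dot v (k *: u) = k * dot v u.
Proof. by rewrite !(dotC v) dotZl. Qed.

Lemma dot0r u : dot u 0 = 0.
Proof. by rewrite dotC dot0l. Qed.

Lemma dotNr u v : dot v (- u) = - dot v u.
Proof. by rewrite !(dotC v) dotNl. Qed.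

Lemma dotBr u v w : dot w (u - v) = dot w u - dot w v.
Proof. by rewrite dotDr dotNr. Qed.

Lemma dot_sumr (I : Type) (r : seq I) (P : pred I) (F : I -> 'rV[R]_l) v :
  dot v (\sum_(i <- r | P i) F i) = \sum_(i <- r | P i) dot v (F i).
Proof. by rewrite dotC dot_suml; apply: eq_bigr => i _; rewrite dotC. Qed.

Lemma dot_gt0 u : u != 0 -> 0 < dot u u.
Proof.
move=> u0; have ge0 : 0 <= dot u u by apply: sumr_ge0 => i _; rewrite -expr2 sqr_ge0.
rewrite lt0r ge0 andbT; apply: contra u0; rewrite /dot psumr_eq0; last first.
  by move=> i _; rewrite -expr2 sqr_ge0.
move=> /allP u0; apply/eqP/rowP => i; rewrite mxE; apply/eqP.
by have /implyP/(_ isT) := u0 i (mem_index_enum _); rewrite mulf_eq0 orbb.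
Qed.

(** Reflection in the zero set of [dot b x + m], that is, in the hyperplane of [b] at level [- m];
    the constant is added, as in an affine root. *)
Definition refl (b : 'rV[R]_l) (m : int) (x : 'rV[R]_l) :=
  x - (dot b x + m%:~R) *: coroot b.

Lemma refl0 b x : refl b 0 x = reflection b x.
Proof. by rewrite /refl /reflection /coroot addr0 scalerA dotC mulrCA mulrA. Qed.

Lemma dot_coroot b : b != 0 -> dot b (coroot b) = 2.
Proof. by move=> /dot_gt0 b0; rewrite dotZr divfK // lt0r_neq0. Qed.

Lemma dot_refl b m x : b != 0 ->
  dot b (refl b m x) + m%:~R = - (dot b x + m%:~R).
Proof. by move=> b0; rewrite dotBr dotZr dot_coroot //; ring. Qed.

Lemma reflK b m x : b != 0 -> refl b m (refl b m x) = x.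
Proof.
by move=> b0; rewrite {1}/refl dot_refl // scaleNr opprK /refl subrK.
Qed.

Lemma dot_refl_out b m b' x :
  dot b' (refl b m x) = dot (reflection b b') x - m%:~R * dot b' (coroot b).
Proof.
rewrite /refl /reflection /coroot dotBr dotZr dotBl !dotZl dotZr; ring.
Qed.

Lemma reflection_linear b k u v :
  reflection b (k *: u + v) = k *: reflection b u + reflection b v.
Proof.
rewrite /reflection dotDl dotZl scalerBr addrACA -opprD; congr (_ - _).
by rewrite scalerA -scalerDl; congr (_ *: _); ring.
Qed.

Lemma dot_reflection b u v : b != 0 ->
  dot (reflection b u) (reflection b v) = dot u v.
Proof.
move=> b0; have /lt0r_neq0 bb := dot_gt0 b0.
rewrite /reflection !(dotBl, dotBr, dotZl, dotZr) (dotC b v) -!mulrA.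
by field.
Qed.

End DotProduct.

(** A class, so that instance search supplies the root system to lemmas whose statements mention
    only [alpha] or [c]. *)
Class root_data (R : realType) (l : nat) (Phi : {fset 'rV[R]_l})
    (alpha : 'I_l -> 'rV[R]_l) (c : 'I_l -> nat) : Prop := RootData {
  rd_root : root_system Phi;
  rd_nonempty : Phi <> fset0;
  rd_simple : simple_system Phi alpha;
  rd_highest : highest_root_coefs Phi alpha c }.

(** * The basis dual to the simple roots *)

Section Coweights.
Context (R : realType) (l : nat) (Phi : {fset 'rV[R]_l})
  (alpha : 'I_l -> 'rV[R]_l) (c : 'I_l -> nat) {RD : root_data Phi alpha c}.

Definition simple_mx (a : 'I_l -> 'rV[R]_l) : 'M[R]_l := \matrix_i a i.

Definition coweight j : 'rV[R]_l := row j (invmx (simple_mx alpha)^T).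

Lemma simple_mx_unit : simple_mx alpha \in unitmx.
Proof.
rewrite -row_free_unit; apply: inj_row_free => v v0.
have sz : size [seq alpha i | i <- enum 'I_l] == l by rewrite size_map size_enum_ord.
have [/andP[_ fr] _ _] := rd_simple.
have /freeP fr' : free (Tuple sz) by [].
apply/rowP => i; rewrite mxE; apply: fr' => //.
rewrite -[RHS]v0 mulmx_sum_row; apply: eq_bigr => j _.
by rewrite rowK /= (nth_map j) ?size_enum_ord // nth_ord_enum.
Qed.

Lemma dot_coweight i j : dot (alpha i) (coweight j) = (i == j)%:R.
Proof.
have /mulVmx/matrixP/(_ j i) : (simple_mx alpha)^T \in unitmx.
  by rewrite unitmx_tr simple_mx_unit.
rewrite !mxE eq_sym => <-; apply: eq_bigr => k _; rewrite !mxE mulrC; congr (_ * _).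
Qed.

Lemma coweight_expand x : x = \sum_i dot (alpha i) x *: coweight i.
Proof.
have U : (simple_mx alpha)^T \in unitmx by rewrite unitmx_tr simple_mx_unit.
rewrite -[LHS](mulmxK U) mulmx_sum_row; apply: eq_bigr => i _; congr (_ *: _).
by rewrite !mxE; apply: eq_bigr => k _; rewrite !mxE mulrC.
Qed.

Lemma simple_expand x : x = \sum_i dot x (coweight i) *: alpha i.
Proof.
have U := simple_mx_unit.
rewrite -[LHS](mulmxKV U) mulmx_sum_row; apply: eq_bigr => i _; rewrite rowK.
by congr (_ *: _); rewrite mxE; apply: eq_bigr => k _; rewrite /coweight -trmx_inv !mxE.
Qed.

Lemma dot_int_comb n x : dot (int_comb alpha n) x = \sum_i (n i)%:~R * dot (alpha i) x.
Proof. by rewrite dot_suml; apply: eq_bigr => i _; rewrite dotZl. Qed.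

Lemma int_comb_coweight n j : dot (int_comb alpha n) (coweight j) = (n j)%:~R.
Proof.
rewrite dot_int_comb (bigD1 j) //= dot_coweight eqxx mulr1 big1 ?addr0 // => i ij.
by rewrite dot_coweight (negbTE ij) mulr0.
Qed.

Lemma dot_inj (u v : 'rV[R]_l) : (forall x, dot u x = dot v x) -> u = v.
Proof.
move=> uv; rewrite (simple_expand u) (simple_expand v).
by apply: eq_bigr => i _; rewrite uv.
Qed.

End Coweights.
Arguments coweight {R l} alpha j.

(** * Affine roots *)

Section AffineRoots.
Context (R : realType) (l : nat) (Phi : {fset 'rV[R]_l})
  (alpha : 'I_l -> 'rV[R]_l) (c : 'I_l -> nat) {RD : root_data Phi alpha c}.
Implicit Types (b x u : 'rV[R]_l) (m : int).
Let PhiR : root_system Phi := @rd_root _ _ _ _ _ RD.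

Definition aff b m x : R := dot b x + m%:~R.

(** Only the affine wall has a constant term: index 0 stands for the affine root
    [1 - (highest root)]. *)
Definition level (i : 'I_l.+1) : int := (i == ord0 : nat)%:Z.

Local Notation bs := (ext_simple alpha c).

(* [lam i] for [0 <= i <= l] are the barycentric coordinates on the fundamental
   alcove, up to the factors [c_i]. *)
Definition bary i x := aff (bs i) (level i) x.

Local Notation lam := bary.

Definition in_alcove u := forall i, 0 < lam i u.

Definition simp i := refl (bs i) (level i).

Lemma root_neq b : b \in Phi -> b != 0.
Proof. by move=> bP; apply: contraTneq bP => ->; exact: root_neq0 PhiR. Qed.

Lemma root_opp b : b \in Phi -> - b \in Phi.
Proof.
move=> bP; have := root_reflection PhiR bP bP.
rewrite /reflection mulfK; last by rewrite lt0r_neq0 // dot_gt0 // root_neq.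
by rewrite scaler_nat mulr2n opprD addrA subrr add0r; apply.
Qed.

Lemma simple_root i : alpha i \in Phi.
Proof. by case: rd_simple. Qed.

Lemma bs_root i : bs i \in Phi.
Proof.
rewrite /ext_simple; case: unlift => [j|] /=; first exact: simple_root.
by apply: root_opp; case: rd_highest.
Qed.

Lemma simple_neq0 i : alpha i != 0.
Proof. exact: root_neq (simple_root i). Qed.

Lemma bs_neq0 i : bs i != 0.
Proof. exact: root_neq (bs_root i). Qed.

Lemma bs_lift i : bs (lift ord0 i) = alpha i.
Proof. by rewrite /ext_simple liftK. Qed.

Lemma bs0 : bs ord0 = - nat_comb alpha c.
Proof. by rewrite /ext_simple unlift_none. Qed.

Lemma lam0E x : lam ord0 x = 1 - dot (nat_comb alpha c) x.
Proof. by rewrite /bary /aff bs0 dotNl /level eqxx addrC. Qed.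

Lemma lam_liftE i x : lam (lift ord0 i) x = dot (alpha i) x.
Proof. by rewrite /bary /aff bs_lift /level addr0. Qed.

Lemma ext_coef0 : ext_coef c ord0 = 1%N.
Proof. by rewrite /ext_coef unlift_none. Qed.

Lemma ext_coef_lift i : ext_coef c (lift ord0 i) = c i.
Proof. by rewrite /ext_coef liftK. Qed.

Lemma highest_coef_gt0 i : (0 < c i)%N.
Proof.
have [_ /(_ _ (simple_root i))[n e]] := rd_highest.
have := congr1 (fun v => dot v (coweight alpha i)) e.
rewrite dotBl !int_comb_coweight dot_coweight eqxx => e'.
by move/eqP: e'; rewrite -!pmulrn subr_eq natr1 eqr_nat => /eqP ->.
Qed.

Lemma ext_coef_gt0 i : (0 < ext_coef c i)%N.
Proof.
by rewrite /ext_coef; case: unlift => //= j; exact: highest_coef_gt0.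
Qed.

Lemma dot_nat_comb n x : dot (nat_comb alpha n) x = \sum_i (n i)%:R * dot (alpha i) x.
Proof. by rewrite dot_int_comb; apply: eq_bigr. Qed.

Lemma sum_lam x : \sum_i (ext_coef c i)%:R * lam i x = 1.
Proof.
rewrite big_ord_recl ext_coef0 lam0E dot_nat_comb mul1r.
under [X in _ + X]eq_bigr do rewrite ext_coef_lift lam_liftE.
by rewrite subrK.
Qed.

(** The constant [k] is [k] times the weighted sum of the [lam i], hence is absorbed into the
    coefficients. *)
Lemma nat_comb_lam (n : 'I_l -> nat) (k : nat) : exists N : 'I_l.+1 -> nat,
  forall x, dot (nat_comb alpha n) x + k%:R = \sum_i (N i)%:R * lam i x.
Proof.
exists (fun i => k * ext_coef c i + oapp n 0 (unlift ord0 i))%N => x.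
under eq_bigr do rewrite natrD mulrDl natrM -mulrA.
rewrite big_split /= -mulr_sumr sum_lam mulr1 addrC; congr (_ + _).
rewrite big_ord_recl unlift_none mul0r add0r dot_nat_comb.
by apply: eq_bigr => i _; rewrite liftK lam_liftE.
Qed.

Lemma aff_opp b m x : aff (- b) (- m) x = - aff b m x.
Proof. by rewrite /aff dotNl intrN opprD. Qed.

(** Let [b] be positive. If the constant is nonnegative, [nat_comb_lam] applies. If it is
    [- (k + 1)], the opposite affine root is [lam ord0 + (highest - b) + k], and [highest - b] is a
    natural combination of simple roots. *)
Lemma root_comb b m : b \in Phi -> exists n : 'I_l.+1 -> nat,
  (forall x, aff b m x = \sum_i (n i)%:R * lam i x) \/
  (forall x, - aff b m x = \sum_i (n i)%:R * lam i x).
Proof.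
move=> bP.
suff pos d k n : d = nat_comb alpha n -> d \in Phi -> exists N : 'I_l.+1 -> nat,
  (forall x, aff d k x = \sum_i (N i)%:R * lam i x) \/
  (forall x, - aff d k x = \sum_i (N i)%:R * lam i x).
  have [_ _ /(_ _ bP)[n [e|e]]] := rd_simple; first exact: pos e bP.
  have e' : - b = nat_comb alpha n by rewrite e opprK.
  have [N [h|h]] := pos _ (- m) _ e' (root_opp bP); exists N.
    by right=> x; rewrite -aff_opp h.
  by left=> x; rewrite -[aff b m x]opprK -aff_opp h.
move=> -> dP; case: k => k.
  by have [N h] := nat_comb_lam n k; exists N; left => x; exact: h.
have [_ /(_ _ dP)[n' e]] := rd_highest.
have [N h] := nat_comb_lam n' k.
exists (fun i => (i == ord0) + N i)%N; right => x.
under eq_bigr do rewrite natrD mulrDl.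
rewrite big_split /= -h big_ord_recl eqxx mul1r big1 ?addr0; last first.
  by move=> i _; rewrite mul0r.
by rewrite lam0E -e dotBl /aff NegzE intrN -pmulrn -natr1; ring.
Qed.

(** The corner of the closed alcove opposite to wall [j]; evaluation there reads off the [j]-th
    coefficient of a combination of the [lam i]. *)
Definition vertex (j : 'I_l.+1) : 'rV[R]_l :=
  oapp (fun k => (c k)%:R^-1 *: coweight alpha k) 0 (unlift ord0 j).

Lemma lam_vertex i j : lam i (vertex j) = (i == j)%:R / (ext_coef c j)%:R.
Proof.
rewrite /vertex; case: (unliftP ord0 j) => [k|] ->; rewrite ?ext_coef0 ?ext_coef_lift.
  have ck : (c k)%:R != 0 :> R by rewrite pnatr_eq0 -lt0n highest_coef_gt0.
  case: (unliftP ord0 i) => [h|] -> /=.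
    by rewrite lam_liftE dotZr dot_coweight mulrC (inj_eq lift_inj).
  by rewrite lam0E dotZr int_comb_coweight -pmulrn mulVf // subrr mul0r.
case: (unliftP ord0 i) => [h|] -> /=.
  by rewrite lam_liftE dot0r mul0r.
by rewrite lam0E dot0r subr0 divr1.
Qed.

Lemma comb_vertex (n : 'I_l.+1 -> R) j :
  \sum_i n i * lam i (vertex j) = n j / (ext_coef c j)%:R.
Proof.
rewrite (bigD1 j) //= lam_vertex eqxx mul1r big1 ?addr0 // => i ij.
by rewrite lam_vertex (negbTE ij) mul0r mulr0.
Qed.

Lemma aff_inj b m b' m' (k : R) :
  (forall x, aff b m x = k * aff b' m' x) -> b = k *: b' /\ m%:~R = k * m'%:~R.
Proof.
move=> h; have h0 := h 0; rewrite /aff !dot0r !add0r in h0.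
split=> //; apply: dot_inj => x; have := h x.
by rewrite /aff h0 mulrDr dotZl => /addIr.
Qed.

(** A natural combination of positive coordinates vanishes only if all its coefficients do, and then
    the root itself would be 0. *)
Lemma aff_neq0 b m u : b \in Phi -> in_alcove u -> aff b m u != 0.
Proof.
move=> bP uA.
have nz (n : 'I_l.+1 -> nat) b' m' : b' \in Phi ->
    (forall x, aff b' m' x = \sum_i (n i)%:R * lam i x) -> aff b' m' u != 0.
  move=> b'P h; apply: contraTneq b'P => e; rewrite (_ : b' = 0) ?(root_neq0 PhiR) //.
  rewrite -(scale0r b'); apply: (proj1 (@aff_inj _ m' _ m' _ _)) => x.
  rewrite mul0r h big1 // => i _; suff -> : n i = 0%N by rewrite mul0r.
  move: e; rewrite h => /eqP; rewrite psumr_eq0 => [/allP/(_ i (mem_index_enum _))|j _].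
    by rewrite mulf_eq0 pnatr_eq0 (gt_eqF (uA i)) orbF => /eqP.
  by rewrite mulr_ge0 // ltW.
have [n [h|h]] := root_comb m bP; first exact: nz h.
by rewrite -oppr_eq0 -aff_opp; apply: nz (root_opp bP) _ => x; rewrite aff_opp; exact: h.
Qed.

Lemma comb_ge0 (n : 'I_l.+1 -> nat) u :
  in_alcove u -> 0 <= \sum_i (n i)%:R * lam i u.
Proof. by move=> uA; apply: sumr_ge0 => i _; rewrite mulr_ge0 // ltW. Qed.

Lemma aff_comb b m u : b \in Phi -> in_alcove u -> 0 <= aff b m u ->
  exists n : 'I_l.+1 -> nat, forall x, aff b m x = \sum_i (n i)%:R * lam i x.
Proof.
move=> bP uA au; have [n [h|h]] := root_comb m bP; first by exists n.
have := comb_ge0 n uA; rewrite -h oppr_ge0 => au'.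
by have := aff_neq0 m bP uA; rewrite eq_le au au'.
Qed.

Lemma simpE i x : simp i x = x - lam i x *: coroot (bs i).
Proof. by []. Qed.

Lemma aff_simp b m i x : aff b m (simp i x) = aff b m x - dot b (coroot (bs i)) * lam i x.
Proof. by rewrite /aff simpE dotBr dotZr; ring. Qed.

Lemma root_int b b' : b \in Phi -> b' \in Phi -> exists k : int,
  dot b (coroot b') = k%:~R.
Proof.
move=> bP b'P; have /Num.Theory.intrP[k e] := root_crystallographic PhiR b'P bP.
by exists k; rewrite -e /coroot dotZr mulrAC.
Qed.

Lemma aff_refl b m b' m' : b \in Phi -> b' \in Phi -> exists k : int,
  forall x, aff b m (refl b' m' x) = aff (reflection b' b) k x.
Proof.
move=> bP b'P; have [k e] := root_int bP b'P.
exists (m - m' * k) => x; rewrite /aff dot_refl_out e intrB intrM; ring.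
Qed.

(** The root is a natural multiple of [bs i], and reducedness leaves 1 as the only natural
    multiple. *)
Lemma comb_single b m (n : 'I_l.+1 -> nat) i : b \in Phi ->
  (forall x, aff b m x = \sum_j (n j)%:R * lam j x) ->
  (forall j, j != i -> n j = 0%N) -> forall x, aff b m x = lam i x.
Proof.
move=> bP h n0 x.
have {h}h y : aff b m y = (n i)%:R * lam i y.
  by rewrite h (bigD1 i) //= big1 ?addr0 // => j /n0 ->; rewrite mul0r.
have e := proj1 (@aff_inj _ m _ (level i) _ h).
have := @root_reduced _ _ _ PhiR (bs i) (n i)%:R (bs_root i); rewrite -e => /(_ bP)[] n1.
  by rewrite h n1 mul1r.
by have := ler0n R (n i); rewrite n1 oppr_ge0 ler10.
Qed.

(* A simple affine reflection maps every positive affine root, other than the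
   one it inverts, to a positive affine root. *)
Lemma simp_positive b m (n : 'I_l.+1 -> nat) i j : b \in Phi ->
  (forall x, aff b m x = \sum_j (n j)%:R * lam j x) -> j != i -> (0 < n j)%N ->
  exists n' : 'I_l.+1 -> nat,
    (forall x, aff b m (simp i x) = \sum_j (n' j)%:R * lam j x) /\
    (forall j, (n' j)%:R = (n j)%:R - dot b (coroot (bs i)) * (i == j)%:R).
Proof.
move=> bP h ji nj.
have [k hk] := aff_refl m (level i) bP (bs_root i).
have ec0 h' : (ext_coef c h')%:R != 0 :> R by rewrite pnatr_eq0 -lt0n ext_coef_gt0.
have [n' [h'|h']] := root_comb k (root_reflection PhiR (bs_root i) bP).
  exists n'; split => [x|j']; first by rewrite hk h'.
  have := h' (vertex j'); rewrite comb_vertex -hk aff_simp h comb_vertex lam_vertex.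
  move=> e; apply: (divIf (ec0 j')); rewrite -e; field.
  exact: ec0.
(* The coefficient at [j] is untouched by [simp i]; being positive, it rules out the nonpositive
   combination. *)
have := h' (vertex j); rewrite comb_vertex -hk aff_simp h comb_vertex lam_vertex.
rewrite (eq_sym i) (negbTE ji) mul0r mulr0 subr0 => e.
have : 0 < (n j)%:R / (ext_coef c j)%:R :> R by rewrite divr_gt0 ?ltr0n ?ext_coef_gt0.
by rewrite -oppr_lt0 e ltNge divr_ge0 ?ler0n.
Qed.

(** Crossing wall [i] changes the side of no hyperplane in another direction. The two directions
    [bs i] and [- bs i] are left out at every level and treated by hand where they occur. *)
Lemma simp_sign b m i u : b \in Phi -> b != bs i -> b != - bs i -> in_alcove u ->
  (0 <= aff b m (simp i u)) = (0 <= aff b m u).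
Proof.
have pos b' m' : b' \in Phi -> b' != bs i -> b' != - bs i -> in_alcove u ->
    0 <= aff b' m' u -> 0 <= aff b' m' (simp i u).
  move=> bP bi bNi uA /(aff_comb bP uA)[n h].
  have [[j ji nj]|no] := pselect (exists2 j, j != i & (0 < n j)%N).
    have [n' [h' _]] := simp_positive bP h ji nj.
    by rewrite h'; exact: comb_ge0.
  have n0 j : j != i -> n j = 0%N.
    by move=> ji; apply/eqP; rewrite eqn0Ngt; apply/negP => nj; apply: no; exists j.
  have /aff_inj[e _] : forall x, aff b' m' x = 1 * aff (bs i) (level i) x.
    by move=> x; rewrite mul1r; exact: comb_single h n0 x.
  by rewrite e scale1r eqxx in bi.
move=> bP bi bNi uA; apply/idP/idP => [sp|]; last exact: pos.
rewrite leNgt; apply/negP => neg.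
have : 0 <= aff (- b) (- m) (simp i u).
  apply: pos => //; rewrite ?eqr_opp ?eqr_oppLR //; first exact: root_opp.
  by rewrite aff_opp oppr_ge0 ltW.
rewrite aff_opp oppr_ge0 => sn.
have [k hk] := aff_refl m (level i) bP (bs_root i).
have := aff_neq0 k (root_reflection PhiR (bs_root i) bP) uA.
by rewrite -hk eq_le sp sn.
Qed.

(** The rank is positive because a zero-dimensional space contains no nonzero vector, hence no
    root. *)
Lemma other_index (i : 'I_l.+1) : exists j, j != i.
Proof.
have l0 : (0 < l)%N.
  rewrite lt0n; apply/eqP => l0; case: (@rd_nonempty _ _ _ _ _ RD).
  apply/fsetP => b; rewrite inE; apply/negP => bP.
  have /negP[] := root_neq bP; apply/eqP/rowP => k; case: k => k lk; exfalso.
  by rewrite l0 in lk.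
by exists (lift i (Ordinal l0)); rewrite eq_sym neq_lift.
Qed.

Lemma in_alcove_lt1 i u : in_alcove u -> lam i u < 1.
Proof.
move=> uA.
have [j ji] : exists j : 'I_l.+1, j != i by exact: other_index.
rewrite -(sum_lam u) (bigD1 i) //= (bigD1 j) //= addrA.
have p1 k : lam k u <= (ext_coef c k)%:R * lam k u.
  by rewrite ler_peMl ?(ltW (uA k)) // ler1n ext_coef_gt0.
have r0 : 0 <= \sum_(k | (k != i) && (k != j)) (ext_coef c k)%:R * lam k u.
  by apply: sumr_ge0 => k _; rewrite mulr_ge0 // ltW.
have := p1 i; have := p1 j; have := uA j; move: r0; lra.
Qed.

(** The witness has all barycentric coordinates equal to [1 / h]: it is the sum of the fundamental
    coweights divided by the Coxeter number. *)
Lemma alcove_point : exists u, in_alcove u.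
Proof.
pose h : R := (coxeter_number c)%:R.
have h0 : 0 < h.
  by rewrite ltr0n /coxeter_number big_ord_recl ext_coef0.
have li i : lam (lift ord0 i) (h^-1 *: \sum_j coweight alpha j) = h^-1.
  rewrite lam_liftE dotZr dot_sumr (bigD1 i) //= dot_coweight eqxx.
  by rewrite big1 ?addr0 ?mulr1 // => j ji; rewrite dot_coweight eq_sym (negbTE ji).
exists (h^-1 *: \sum_j coweight alpha j) => i.
case: (unliftP ord0 i) => [j|] ->; first by rewrite li invr_gt0.
have := sum_lam (h^-1 *: \sum_j coweight alpha j).
rewrite big_ord_recl ext_coef0 mul1r => /(canRL (addrK _)) ->.
under eq_bigr do rewrite li ext_coef_lift.
rewrite -mulr_suml subr_gt0 ltr_pdivrMr // mul1r -natr_sum ltr_nat.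
rewrite /coxeter_number big_ord_recl ext_coef0 add1n ltnS.
by under [X in (_ <= X)%N]eq_bigr do rewrite ext_coef_lift.
Qed.

End AffineRoots.

(** * The affine Weyl group acts simply transitively on alcoves *)

Section WeylGroup.
Context (R : realType) (l : nat) (Phi : {fset 'rV[R]_l})
  (alpha : 'I_l -> 'rV[R]_l) (c : 'I_l -> nat) {RD : root_data Phi alpha c}.
Implicit Types (b x u : 'rV[R]_l) (m : int) (w : 'rV[R]_l -> 'rV[R]_l).
Let PhiR : root_system Phi := @rd_root _ _ _ _ _ RD.

Local Notation bs := (ext_simple alpha c).
Local Notation lam := (bary alpha c).
Local Notation in_alcove := (in_alcove alpha c).
Local Notation simp := (simp alpha c).
Local Notation W := (weyl_group Phi).
Local Notation Q := (coroot_lattice alpha).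
Local Notation Z := (coweight_lattice alpha).

Lemma weyl_linear w : W w -> linear w.
Proof.
by elim=> [|a w' aP _ IH] k u v //=; rewrite IH reflection_linear.
Qed.

Lemma weylD w u v : W w -> w (u + v) = w u + w v.
Proof. by move=> /weyl_linear/(_ 1 u v); rewrite !scale1r. Qed.

Lemma weyl0 w : W w -> w 0 = 0.
Proof. by move=> Ww; apply: (addIr (w 0)); rewrite -weylD // !add0r. Qed.

Lemma weylZ w k u : W w -> w (k *: u) = k *: w u.
Proof.
by move=> Ww; rewrite -[k *: u]addr0 weyl_linear // weyl0 // addr0.
Qed.

Lemma weylN w u : W w -> w (- u) = - w u.
Proof. by move=> Ww; rewrite -scaleN1r weylZ // scaleN1r. Qed.

Lemma weylB w u v : W w -> w (u - v) = w u - w v.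
Proof. by move=> Ww; rewrite weylD // weylN. Qed.

Lemma weyl_dot w u v : W w -> dot (w u) (w v) = dot u v.
Proof.
by elim=> [|a w' aP _ IH] //=; rewrite dot_reflection // (root_neq aP).
Qed.

Lemma weyl_root w b : W w -> b \in Phi -> w b \in Phi.
Proof. by elim=> [|a w' aP _ IH] //= bP; apply: root_reflection => //; exact: IH. Qed.

Lemma weyl_comp w w' : W w -> W w' -> W (w \o w').
Proof. by elim=> [|a v aP _ IH] // /IH; exact: weyl_mul. Qed.

Lemma weyl_reflection b : b \in Phi -> W (reflection b).
Proof. by move=> bP; apply: (weyl_mul bP (@weyl_id _ _ Phi)). Qed.

Lemma reflectionK b : b \in Phi -> involutive (reflection b).
Proof. by move=> bP x; rewrite -!refl0 reflK // (root_neq bP). Qed.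

Lemma weyl_inv w : W w -> exists w', [/\ W w', cancel w w' & cancel w' w].
Proof.
elim=> [|a v aP _ [v' [Wv' vK v'K]]]; first by exists id; split => //; exact: weyl_id.
exists (v' \o reflection a); split => [|x|x] /=.
- exact: weyl_comp Wv' (weyl_reflection aP).
- by rewrite reflectionK.
- by rewrite v'K reflectionK.
Qed.

Lemma weyl_coroot w b : W w -> w (coroot b) = coroot (w b).
Proof. by move=> Ww; rewrite /coroot weylZ // weyl_dot. Qed.

Lemma coroot_lattice0 : Q 0.
Proof.
by exists (fun=> 0) => //; rewrite /int_comb big1 // => i _; rewrite scale0r.
Qed.

Lemma coroot_latticeB x y : Q x -> Q y -> Q (x - y).
Proof.
move=> [n _ <-] [k _ <-]; exists (fun i => n i - k i) => //.
rewrite /int_comb -sumrN -big_split; apply: eq_bigr => i _.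
by rewrite intrB scalerBl.
Qed.

Lemma coroot_latticeN x : Q x -> Q (- x).
Proof. by rewrite -sub0r; apply: coroot_latticeB; exact: coroot_lattice0. Qed.

Lemma coroot_latticeD x y : Q x -> Q y -> Q (x + y).
Proof. by move=> Qx /coroot_latticeN; rewrite -{2}(opprK y); exact: coroot_latticeB. Qed.

Lemma coroot_latticeZ (k : int) x : Q x -> Q (k%:~R *: x).
Proof.
move=> [n _ <-]; exists (fun i => k * n i) => //.
rewrite /int_comb scaler_sumr; apply: eq_bigr => i _.
by rewrite scalerA intrM.
Qed.

Lemma simple_coroot i : Q (coroot (alpha i)).
Proof.
exists (fun j => (i == j : nat)%:Z) => //; rewrite /int_comb (bigD1 i) //= eqxx scale1r.
by rewrite big1 ?addr0 // => j ji; rewrite eq_sym (negbTE ji) scale0r.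
Qed.

Lemma coweight_int b x : b \in Phi -> Z x -> exists k : int, dot b x = k%:~R.
Proof.
move=> bP Zx.
have nat_int n : dot (nat_comb alpha n) x \is a Num.int.
  rewrite dot_int_comb; apply: rpred_sum => i _.
  by rewrite rpredM // intr_int.
have [_ _ /(_ _ bP)[n [->|->]]] := @rd_simple _ _ _ _ _ RD.
  exact/Num.Theory.intrP/nat_int.
by rewrite dotNl; apply/Num.Theory.intrP; rewrite rpredN.
Qed.

Lemma coweight_latticeB x y : Z x -> Z y -> Z (x - y).
Proof. by move=> Zx Zy i; rewrite dotBr rpredB. Qed.

Lemma coweight_latticeD x y : Z x -> Z y -> Z (x + y).
Proof. by move=> Zx Zy i; rewrite dotDr rpredD. Qed.

(** * Words in the simple affine reflections *)

Definition act (s : seq 'I_l.+1) x := foldr simp x s.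

Lemma act_cat s t x : act (s ++ t) x = act s (act t x).
Proof. by rewrite /act foldr_cat. Qed.

Lemma simpK i : involutive (simp i).
Proof. by move=> x; rewrite /simp reflK // bs_neq0. Qed.

Lemma act_rev s x : act (rev s) (act s x) = x.
Proof. by elim: s x => //= i s IH x; rewrite rev_cons -cats1 act_cat /= simpK IH. Qed.

Lemma aff_act s b m : b \in Phi ->
  exists b' m', b' \in Phi /\ forall x, aff b m (act s x) = aff b' m' x.
Proof.
elim: s b m => [|i s IH] b m bP; first by exists b, m.
have [k hk] := aff_refl m (level i) bP (bs_root i).
have [b' [m' [b'P h]]] := IH _ k (root_reflection PhiR (bs_root i) bP).
by exists b', m'; split => // x; rewrite -h -hk.
Qed.

Lemma lam_simp i x : lam i (simp i x) = - lam i x.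
Proof. by rewrite /bary /aff dot_refl // bs_neq0. Qed.

Lemma aff_split b m x : aff b m x = dot b x + aff b m 0.
Proof. by rewrite /aff dot0r add0r. Qed.

(* Induction on [\sum_i n i]: as [dot b b > 0], some [bs i] with [n i > 0] has
   positive product with [b], so that [simp i] lowers the sum. *)
Lemma aff_root_conj b m (n : 'I_l.+1 -> nat) : b \in Phi ->
  (forall x, aff b m x = \sum_i (n i)%:R * lam i x) ->
  exists s i, (n ord0 = 0%N -> ord0 \notin i :: s) /\
    forall x, aff b m (act s x) = lam i x.
Proof.
have [N] := ubnP (\sum_i n i)%N; elim: N b m n => // N IH b m n nN bP h.
have bE : b = \sum_i (n i)%:R *: bs i.
  apply: dot_inj => x; apply: (addIr (aff b m 0)).
  rewrite -aff_split !h dot_suml -big_split; apply: eq_bigr => i _ /=.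
  by rewrite /bary aff_split mulrDr dotZl.
have [i ni bi] : exists2 i, (0 < n i)%N & 0 < dot b (bs i).
  apply/not_exists2P => no; suff : dot b b <= 0 by rewrite leNgt dot_gt0 ?(root_neq bP).
  rewrite {2}bE dot_sumr; apply: sumr_le0 => i _; rewrite dotZr.
  have [/negP|/negP] := no i; first by rewrite -eqn0Ngt => /eqP ->; rewrite mul0r.
  by rewrite -leNgt; exact: mulr_ge0_le0.
have n0i : n ord0 = 0%N -> ord0 != i by move=> n0; apply: contraTneq ni => <-; rewrite n0.
have [[j ji nj]|no] := pselect (exists2 j, j != i & (0 < n j)%N); last first.
  exists [::], i; split=> [n0|x]; first by rewrite inE n0i.
  apply: comb_single h _ x => // j ji.
  by apply/eqP; rewrite eqn0Ngt; apply/negP => nj; apply: no; exists j.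
have [n' [h' n'E]] := simp_positive bP h ji nj.
have [k hk] := aff_refl m (level i) bP (bs_root i).
have k0 : 0 < dot b (coroot (bs i)).
  by rewrite dotZr mulr_gt0 ?divr_gt0 // dot_gt0 ?bs_neq0.
have [||s [i' [n0' hs]]] := IH _ k n' _ (root_reflection PhiR (bs_root i) bP).
- rewrite -ltnS (leq_trans _ nN) // ltnS -(ltr_nat R) !natr_sum.
  under eq_bigr do rewrite n'E.
  rewrite sumrB -mulr_sumr (_ : \sum_j' (i == j')%:R = 1).
    by rewrite mulr1 gtrBl.
  by rewrite (bigD1 i) //= eqxx big1 ?addr0 // => j' /negbTE; rewrite eq_sym => ->.
- by move=> x; rewrite -hk; exact: h'.
exists (i :: s), i'; split=> [n0|x]; last by rewrite /= -hs -hk.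
(* If coefficient 0 vanishes, then [i] is not 0 and the coefficient stays 0 after [simp i]; so an
   ordinary positive root is conjugated by finite reflections only. *)
have := n'E ord0; rewrite n0 eq_sym (negbTE (n0i n0)) mulr0 subr0 => /eqP.
rewrite eqr_nat => /eqP/n0'; rewrite !inE !negb_or => /andP[-> ->].
by rewrite n0i.
Qed.

Lemma refl_opp b m x : refl (- b) (- m) x = refl b m x.
Proof.
rewrite /refl /coroot dotNl dotNr dotNl opprK scalerN intrN -opprD.
by rewrite scaleNr scalerN opprK.
Qed.

Lemma weyl_pullback w g b m b' m' : W w ->
  (forall x, aff b m (w x + g) = aff b' m' x) -> b = w b'.
Proof.
move=> Ww h; have [v [Wv wv vw]] := weyl_inv Ww.
apply: dot_inj => y; rewrite -(vw y) weyl_dot //.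
apply: (addIr (aff b' m' 0)); rewrite -aff_split -!h weyl0 // add0r.
by rewrite /aff dotDr addrA.
Qed.

(** Conjugating a reflection by an isometry gives the reflection in the image of the mirror. *)
Lemma refl_conj w g b m b' m' : W w ->
  (forall x, aff b m (w x + g) = aff b' m' x) ->
  forall x, refl b m (w x + g) = w (refl b' m' x) + g.
Proof.
move=> Ww h x; have e := weyl_pullback Ww h.
rewrite /refl -!/(aff _ _ _) h (weylB _ _ Ww) (weylZ _ _ Ww) (weyl_coroot _ Ww) -e.
by rewrite addrAC.
Qed.

Lemma coroot_lattice_reflection i x : Q x -> Q (reflection (alpha i) x).
Proof.
move=> Qx; suff [k e] : exists k : int, dot (alpha i) x = k%:~R.
  rewrite -refl0 /refl addr0 e; apply: coroot_latticeB => //.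
  exact: coroot_latticeZ (simple_coroot i).
case: Qx => n _ <-; rewrite dot_sumr; apply/Num.Theory.intrP/rpred_sum => j _.
have [k e] := root_int (simple_root i) (simple_root j).
by rewrite dotZr e -intrM intr_int.
Qed.

Lemma simp_lift i x : simp (lift ord0 i) x = reflection (alpha i) x.
Proof. by rewrite /simp bs_lift -refl0. Qed.

Lemma act_finite s : ord0 \notin s -> W (act s) /\ forall x, Q x -> Q (act s x).
Proof.
elim: s => [|i s IH]; first by split=> //; exact: weyl_id.
rewrite inE negb_or; case: (unliftP ord0 i) => [j|] ->; last by rewrite eqxx.
move=> /andP[_ /IH[Ws Qs]]; split=> [|x /Qs Qx] /=.
  rewrite (_ : act _ = reflection (alpha j) \o act s).
    exact: weyl_mul (simple_root j) Ws.
  by apply/funext => x; rewrite /= simp_lift.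
by rewrite simp_lift; exact: coroot_lattice_reflection.
Qed.

(** A positive root is carried to a simple one by a word without the affine reflection; such words
    preserve the span of the simple coroots. *)
Lemma coroot_in_lattice b : b \in Phi -> Q (coroot b).
Proof.
have pos d n : d = nat_comb alpha n -> d \in Phi -> Q (coroot d).
  move=> dE dP.
  have [|s [i [/(_ _)]]] := @aff_root_conj d 0 (fun i => oapp n 0%N (unlift ord0 i)) dP _.
    move=> x; rewrite /aff addr0 big_ord_recl unlift_none mul0r add0r dE dot_nat_comb.
    by apply: eq_bigr => i _; rewrite liftK lam_liftE.
  rewrite unlift_none inE negb_or => /(_ erefl)/andP[i0 /act_finite[Ws Qs]] hs.
  have -> : d = act s (bs i).
    by apply: (weyl_pullback (g := 0) Ws) => x; rewrite addr0; exact: hs.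
  rewrite -weyl_coroot //; apply: Qs.
  case: (unliftP ord0 i) i0 => [j|] ->; last by rewrite eqxx.
  by rewrite bs_lift => _; exact: simple_coroot.
move=> bP; have [_ _ /(_ _ bP)[n [e|e]]] := @rd_simple _ _ _ _ _ RD.
  exact: pos e bP.
have : Q (coroot (- b)) by apply: pos (root_opp bP); rewrite e opprK.
move=> /coroot_latticeN.
by rewrite /coroot dotNl dotNr opprK scalerN opprK.
Qed.

Lemma act_weyl s : exists w g, [/\ W w, Q g & forall x, act s x = w x + g].
Proof.
elim: s => [|i s [w [g [Ww Qg h]]]].
  exists id, 0; split => [||x]; [exact: weyl_id|exact: coroot_lattice0|by rewrite addr0].
have Qc : Q (coroot (bs i)) by exact: coroot_in_lattice (bs_root i).
exists (reflection (bs i) \o w), (refl (bs i) (level i) g); split => [||x].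
- exact: weyl_mul (bs_root i) Ww.
- have [k e] : exists k : int, dot (bs i) g = k%:~R.
    case: Qg => n _ <-; rewrite dot_sumr; apply/Num.Theory.intrP/rpred_sum => j _.
    have [k e] := root_int (bs_root i) (simple_root j).
    by rewrite dotZr e -intrM intr_int.
  by rewrite /refl e -intrD; apply: coroot_latticeB => //; exact: coroot_latticeZ Qc.
- rewrite /= h /simp -refl0 /refl dotDr addr0 -[dot _ _ + _ + _]addrA scalerDl opprD.
  by rewrite addrACA.
Qed.

Definition is_word (f : 'rV[R]_l -> 'rV[R]_l) := exists s, forall x, act s x = f x.

Lemma is_word_comp f g : is_word f -> is_word g -> is_word (f \o g).
Proof. by move=> [s hs] [t ht]; exists (s ++ t) => x; rewrite act_cat ht hs. Qed.

(** A word [s] takes the mirror to a wall [i] of the fundamental alcove, so the reflection is the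
    conjugate [s i s^-1]. *)
Lemma refl_is_word b m : b \in Phi -> is_word (refl b m).
Proof.
move=> bP.
have pos d k (n : 'I_l.+1 -> nat) : d \in Phi ->
    (forall x, aff d k x = \sum_i (n i)%:R * lam i x) -> is_word (refl d k).
  move=> dP /(aff_root_conj dP)[s [i [_ hs]]].
  have [w [g [Ww Qg h]]] := act_weyl s.
  exists (s ++ i :: rev s) => x.
  have -> : x = act s (act (rev s) x) by rewrite -{1}(revK s) act_rev.
  rewrite act_cat /= act_rev [in RHS]h (refl_conj (b' := bs i) (m' := level i)) //.
  by move=> y; rewrite -h; exact: hs.
have [n [h|h]] := root_comb m bP; first exact: pos h.
have [s hs] : is_word (refl (- b) (- m)).
  by apply: pos (root_opp bP) _ => x; rewrite aff_opp; exact: h.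
by exists s => x; rewrite hs refl_opp.
Qed.

Lemma weyl_is_word w g : W w -> Q g -> is_word (fun x => w x + g).
Proof.
move=> Ww Qg; have Hw : is_word w.
  elim: Ww => [|a v aP _ IH]; first by exists [::].
  apply: is_word_comp IH; have [s hs] := refl_is_word 0 aP.
  by exists s => x; rewrite hs refl0.
have Hg : is_word (fun x => x + g); last exact: is_word_comp Hg Hw.
case: Qg => n _ <-; apply: (big_ind (fun g => is_word (fun x => x + g))) => [|g1 g2 h1 h2|i _].
- by exists [::] => x; rewrite addr0.
- by have [s hs] := is_word_comp h2 h1; exists s => x; rewrite hs /= addrA.
- have ai : alpha i != 0 by exact: simple_neq0.
  (* Reflecting in two parallel mirrors of [alpha i], at levels 0 and [n i], translates by [n i]
     times its coroot. *)
  have [s hs] := is_word_comp (refl_is_word (- n i) (simple_root i))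
                             (refl_is_word 0 (simple_root i)).
  exists s => x; rewrite hs /= {1}/refl.
  have -> : dot (alpha i) (refl (alpha i) 0 x) = - dot (alpha i) x.
    by have := dot_refl 0 x ai; rewrite !addr0.
  rewrite /refl addr0 -addrA; congr (_ + _).
  by rewrite -!scaleNr -scalerDl; congr (_ *: _); rewrite intrN; ring.
Qed.

(** * Transitivity and freeness on alcoves *)

Definition regular p := forall b m, b \in Phi -> aff b m p != 0.

Lemma regular_act s p : regular p -> regular (act s p).
Proof. by move=> rp b m bP; have [b' [m' [b'P ->]]] := aff_act s m bP; exact: rp. Qed.

Lemma big_roots_reflection b (F : 'rV[R]_l -> nat) : b \in Phi ->
  (\sum_(d <- Phi) F (reflection b d) = \sum_(d <- Phi) F d)%N.
Proof.
move=> bP; rewrite -(big_map (reflection b) xpredT F); apply: perm_big.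
have bij := reflectionK bP.
apply: uniq_perm; rewrite ?map_inj_uniq ?fset_uniq //; first exact: inv_inj.
move=> d; apply/mapP/idP => [[d' d'P ->]|dP]; first exact: root_reflection.
by exists (reflection b d); rewrite ?bij //; exact: root_reflection.
Qed.

Lemma floor_inj (x y : R) : (forall m : int, (0 <= x + m%:~R) = (0 <= y + m%:~R)) ->
  Num.floor x = Num.floor y.
Proof.
move=> h; have le (m : int) : (m <= Num.floor x) = (m <= Num.floor y).
  by rewrite !floor_ge_int -subr_ge0 -mulrNz h mulrNz subr_ge0.
by apply: le_anti; rewrite -le lexx le lexx.
Qed.

(* [\sum_b |floor (dot b p) - floor (dot b u)|] is twice the number of
   hyperplanes separating [p] from the fundamental alcove; reflecting [p] in a
   wall that separates it from the alcove decreases it. *)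
Lemma act_into_alcove p : regular p -> exists s, in_alcove (act s p).
Proof.
have [u uA] := @alcove_point _ _ _ _ _ RD.
pose D p (b : 'rV[R]_l) : nat := `|Num.floor (dot b p) - Num.floor (dot b u)|%N.
have [N] := ubnP (\sum_(b <- Phi) D p b)%N.
elim: N p => // N IH p pN rp.
have [pA|] := pselect (in_alcove p); first by exists [::].
move=> /existsNP[i /negP]; rewrite -leNgt le_eqVlt (negbTE (rp _ _ (bs_root i))) /= => pi.
have [||s sA] := IH (simp i p); last by exists (rcons s i); rewrite -cats1 act_cat.
  2: exact: (@regular_act [:: i]).
rewrite -ltnS (leq_trans _ pN) // ltnS.
rewrite -(big_roots_reflection (D p) (bs_root i)).
have E b : b \in Phi -> D p (reflection (bs i) b) =
    `|Num.floor (dot b (simp i p)) - Num.floor (dot b (simp i u))|%N.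
  move=> bP; have [k hk] := aff_refl 0 (level i) bP (bs_root i).
  have fl x : Num.floor (dot b (simp i x)) = Num.floor (dot (reflection (bs i) b) x) + k.
    by have := hk x; rewrite {1}/aff addr0 => ->; rewrite floorDrz ?intr_int // intrKfloor.
  by rewrite !fl /D; congr absz; ring.
have lamu : lam i u < 1 by exact: in_alcove_lt1.
have lamu0 := uA i.
have f0 : Num.floor (lam i u) = 0.
  by apply/eqP; rewrite floor_eq add0r mulr0z lamu ltW.
have fN : Num.floor (- lam i u) = -1.
  by apply/eqP; rewrite floor_eq addNr mulr0z oppr_lt0 mulrN1z lerN2 lamu0 ltW.
have fbs x : Num.floor (dot (bs i) x) = Num.floor (lam i x) - level i.
  by rewrite /bary /aff floorDrz ?intr_int // intrKfloor addrK.
have fbsN x : Num.floor (dot (- bs i) x) = Num.floor (- lam i x) + level i.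
  by rewrite /bary /aff opprD -dotNl -intrN floorDrz ?intr_int // intrKfloor subrK.
have fp : 0 <= Num.floor (- lam i p) by rewrite floor_ge0 oppr_ge0 ltW.
have fp' : Num.floor (lam i p) <= -1 by rewrite -ltzD1 addNr floor_lt0.
(* In direction [bs i] both gaps are measured from [floor (- lam i p)], which is nonnegative: to the
   alcove, at floor 0, and to its mirror image, at floor -1. The first is smaller by one. *)
have lt : (D (simp i p) (bs i) < D p (reflection (bs i) (bs i)))%N.
  rewrite E ?bs_root // /D !fbs !lam_simp f0 fN.
  by lia.
have le b : b \in Phi -> (D (simp i p) b <= D p (reflection (bs i) b))%N.
  move=> bP; rewrite E //.
  have [->|bi] := eqVneq b (bs i); first by rewrite -E ?bs_root // ltnW.
  have [->|bNi] := eqVneq b (- bs i).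
    by rewrite /D !fbsN !lam_simp !opprK f0 fN; lia.
  rewrite /D (@floor_inj (dot b (simp i u)) (dot b u)) // => m.
  exact: simp_sign.
rewrite (big_rem (bs i)) ?bs_root //= [X in (_ < X)%N](big_rem (bs i)) ?bs_root //=.
rewrite -addSn leq_add // big_seq [leqRHS]big_seq; apply: leq_sum => b /mem_rem bP.
exact: le.
Qed.

Lemma alcove_cover p : regular p -> exists w g u,
  [/\ W w, Q g, in_alcove u & p = w u + g].
Proof.
move=> /act_into_alcove[s sA]; have [w [g [Ww Qg h]]] := act_weyl (rev s).
by exists w, g, (act s p); rewrite -h act_rev.
Qed.

(** By [simp_sign] only the directions [bs t] and [- bs t] can separate [u] from [simp t u];
    integrality of [m] and [0 < lam t u < 1] then fix the orientation and the level. *)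
Lemma sign_change b m t u : b \in Phi -> in_alcove u ->
  aff b m u < 0 -> 0 < aff b m (simp t u) -> forall x, aff b m x = - lam t x.
Proof.
move=> bP uA neg pos x; have u0 := uA t.
have u1 : lam t u < 1 by exact: in_alcove_lt1.
have split_lam d k y : aff d k y = dot d y + k%:~R by [].
have lamE y : dot (bs t) y = lam t y - (level t)%:~R.
  by rewrite /bary /aff addrK.
have [e|bt] := eqVneq b (bs t).
  by move: neg pos; rewrite !split_lam e !lamE lam_simp; lra.
have [e|bNt] := eqVneq b (- bs t); last first.
  have : 0 <= aff b m u by rewrite -(simp_sign m bP bt bNt uA) ltW.
  by rewrite leNgt neg.
move: neg pos; rewrite !split_lam e !dotNl !lamE lam_simp => neg pos.
have : m + level t < 1 by rewrite -(ltr_int R) intrD; lra.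
have : -1 < m + level t by rewrite -(ltr_int R) intrD mulrN1z; lra.
move=> h1 h2; have /eqP : m + level t = 0 by lia.
by rewrite -(intr_eq0 R) intrD => /eqP; lra.
Qed.

(** The gallery is beyond wall [i] after [s1] and back at the end; [t] is the first letter at which
    it returns. No intermediate point lies on the wall, so the side always makes sense. *)
Lemma first_crossing i u s2 s1 : in_alcove u ->
  lam i (act s1 u) < 0 -> 0 < lam i (act (s1 ++ s2) u) ->
  exists t1 t t2, [/\ s2 = t1 ++ t :: t2, lam i (act (s1 ++ t1) u) < 0
    & 0 < lam i (act (s1 ++ t1) (simp t u))].
Proof.
move=> uA; elim: s2 s1 => [|t s2 IH] s1 neg.
  by rewrite cats0 ltNge ltW.
have [pos _|neg'] := ltP 0 (lam i (act (s1 ++ [:: t]) u)).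
  by exists [::], t, s2; rewrite cats0; split=> //; move: pos; rewrite act_cat.
rewrite -cat1s catA => /IH[].
  rewrite lt_neqAle neg' andbT.
  have [b' [m' [b'P h]]] := aff_act (s1 ++ [:: t]) (level i) (bs_root i).
  by rewrite /bary h aff_neq0.
move=> t1 [t' [t2 [-> n p]]]; exists (t :: t1), t', t2.
by rewrite -catA in n p.
Qed.

(* Deletion: a gallery from the alcove back to itself crosses its first wall a
   second time, and the part between the crossings can be reflected away. *)
Lemma act_alcove_id s u : in_alcove u -> in_alcove (act s u) -> forall x, act s x = x.
Proof.
move=> uA; have [N] := ubnP (size s); elim: N s => // N IH [//|i s] /= sN sA x.
have [||t1 [t [t2 [sE neg pos]]]] := @first_crossing i u s [:: i] uA.
- by rewrite /= lam_simp oppr_lt0.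
- exact: sA.
have [w [g [Ww Qg h]]] := act_weyl (i :: t1).
(* The image of wall [t] under the prefix is wall [i] itself, so [simp i] moves through the prefix
   and becomes [simp t], cancelling that letter. *)
have comm y : simp i (act (i :: t1) y) = act (i :: t1) (simp t y).
  rewrite !h /simp -(refl_opp (bs t)); apply: refl_conj => // z.
  have [b' [m' [b'P h']]] := aff_act (i :: t1) (level i) (bs_root i).
  by rewrite aff_opp -h h'; apply: (sign_change b'P uA); rewrite -h'.
have del y : simp i (act s y) = act (t1 ++ t2) y.
  have -> : simp i (act s y) = act (i :: t1) (simp t (act t2 y)) by rewrite sE /= act_cat.
  by rewrite -comm /= simpK act_cat.
rewrite del; apply: IH => [|j]; last by rewrite -del; exact: sA.
by move: sN; rewrite sE !size_cat /=; lia.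
Qed.

Lemma coroot_coweight x : Q x -> Z x.
Proof.
move=> [n _ <-] i; rewrite dot_sumr; apply/rpred_sum => j _.
have [k e] := root_int (simple_root i) (simple_root j).
by rewrite dotZr e -intrM intr_int.
Qed.

(** The Weyl group acts trivially on [Z / Q]: a reflection subtracts an integral multiple of a
    coroot from a coweight. *)
Lemma weyl_coweight w x : W w -> Z x -> Z (w x) /\ Q (x - w x).
Proof.
move=> Ww Zx; elim: Ww => [|b v bP Wv [Zv Qv]].
  by split=> //; rewrite subrr; exact: coroot_lattice0.
have [k e] := coweight_int bP Zv.
have Qb : Q (coroot b) by exact: coroot_in_lattice.
have E : (reflection b \o v) x = v x - k%:~R *: coroot b.
  by rewrite /= -refl0 /refl e addr0.
rewrite E; split; last first.
  by rewrite opprB addrCA addrC; apply: coroot_latticeD => //; exact: coroot_latticeZ.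
by apply: coweight_latticeB => //; apply: coroot_coweight; exact: coroot_latticeZ.
Qed.

Lemma weyl_coroot_lattice w x : W w -> Q x -> Q (w x).
Proof.
move=> Ww Qx; have [_ Qxw] := weyl_coweight Ww (coroot_coweight Qx).
by rewrite -[w x](subKr x); exact: coroot_latticeB.
Qed.

Lemma alcove_unique w w' g g' u u' : W w -> W w' -> Q g -> Q g' ->
  in_alcove u -> in_alcove u' -> w u + g = w' u' + g' -> w = w' /\ g = g'.
Proof.
move=> Ww Ww' Qg Qg' uA uA' e.
have [v [Wv wv vw]] := weyl_inv Ww.
have [|s hs] := weyl_is_word (weyl_comp Wv Ww') (_ : Q (v (g' - g))).
  by apply: weyl_coroot_lattice => //; exact: coroot_latticeB.
have id_s : forall x, act s x = x.
  apply: (act_alcove_id uA'); rewrite hs /= -weylD // addrA -e addrK wv.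
  exact: uA.
have eqx x : w' x + g' = w x + g.
  by rewrite -{2}(id_s x) hs /= -weylD // vw addrA subrK.
have eg : g = g' by have := eqx 0; rewrite !weyl0 // !add0r.
by split=> //; apply/funext => x; have := eqx x; rewrite eg => /addIr.
Qed.

End WeylGroup.

(** * Natural solutions of a linear equation *)

Section SetCard.

Lemma set_card_seq (T : choiceType) (A : set T) (s : seq T) :
  uniq s -> (forall x, A x <-> x \in s) -> set_card A = size s.
Proof.
move=> us h; rewrite /set_card; have fA : finite_set A.
  by rewrite (_ : A = [set` s]) //; apply/seteqP; split=> x /h.
apply/perm_size/uniq_perm; rewrite ?fset_uniq // => x.
by rewrite in_fset_set //; apply/idP/idP; rewrite inE => /h.
Qed.

Lemma set_card_image (T U : choiceType) (f : T -> U) (A : set T) :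
  finite_set A -> set_inj A f -> set_card (f @` A) = set_card A.
Proof.
move=> fA inj; rewrite /set_card fset_set_image // card_in_imfset //=.
by move=> x y; rewrite !in_fset_set // => xA yA; apply: inj.
Qed.

Lemma sum_pairs (T U : choiceType) (A : set T) (B : set U) (P : T -> U -> bool) :
  finite_set A -> finite_set B ->
  (\sum_(a <- fset_set A) \sum_(b <- fset_set B) P a b)%N =
    set_card [set p | [/\ A p.1, B p.2 & P p.1 p.2]].
Proof.
move=> fA fB.
rewrite (@set_card_seq _ _ [seq p <- [seq (a, b) | a <- fset_set A, b <- fset_set B] | P p.1 p.2]).
- rewrite -(big_allpairs (F := fun p => nat_of_bool (P p.1 p.2))) /= size_filter -sum1_count.
  by rewrite [RHS]big_mkcond; apply: eq_bigr => p _; case: P.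
- by rewrite filter_uniq // allpairs_uniq ?fset_uniq // => -[? ?] [? ?] _ _ [-> ->].
- move=> [a b]; rewrite mem_filter /=; split=> [[Aa Bb ->]|/andP[-> /allpairsP[[a' b']]]] /=.
    by apply/allpairsP; exists (a, b); rewrite /= !in_fset_set // !inE.
  by rewrite !in_fset_set // !inE => -[Aa Bb [-> ->]].
Qed.

Lemma set_card_partition (T : choiceType) (F : finType) (f : T -> F) (A : set T) :
  finite_set A -> set_card A = (\sum_r set_card (A `&` [set x | f x = r]))%N.
Proof.
move=> fA; rewrite /set_card -sum1_size (partition_big f predT) //=.
apply: eq_bigr => r _.
have -> : fset_set (A `&` [set x | f x = r]) = [fset x in fset_set A | f x == r]%fset.
  apply/fsetP => x; rewrite in_fset_set; last exact: sub_finite_set (@subIsetl _ _ _) fA.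
  rewrite !inE /= in_fset_set //; apply/idP/andP => [|[]]; rewrite !inE /=.
    by move=> [Ax <-].
  by move=> Ax /eqP.
rewrite /= sum1_count -size_filter; apply/perm_size/uniq_perm;
  rewrite ?filter_uniq ?fset_uniq // => x.
by rewrite mem_filter !inE andbC.
Qed.

End SetCard.

(** * Solutions of the weighted equation and their quasi-polynomial *)

Section CountingSolutions.
Variables (n : nat) (d : 'I_n.+1 -> nat).
Hypothesis d_gt0 : forall i, (0 < d i)%N.

Definition weighted_solutions (q : nat) : set {ffun 'I_n.+1 -> nat} :=
  [set x | (\sum_i d i * x i = q)%N].

Local Notation solutions := weighted_solutions.

Lemma solution_le q x i : solutions q x -> (x i <= q)%N.
Proof.
move=> <-; rewrite (bigD1 i) //= (leq_trans _ (leq_addr _ _)) //.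
by rewrite leq_pmull.
Qed.

Lemma bounded_finite q (A : set {ffun 'I_n.+1 -> nat}) :
  (forall x i, A x -> (x i <= q)%N) -> finite_set A.
Proof.
move=> Aq.
pose F (f : {ffun 'I_n.+1 -> 'I_q.+1}) : {ffun 'I_n.+1 -> nat} := [ffun i => val (f i)].
apply: (@sub_finite_set _ _ (range F)); last exact: finite_image.
move=> x Ax; exists [ffun i => inord (x i)] => //.
by apply/ffunP => i; rewrite !ffunE /= inordK // ltnS; exact: Aq.
Qed.

Lemma solutions_finite q : finite_set (solutions q).
Proof. by apply: (@bounded_finite q) => x i; exact: solution_le. Qed.

Lemma card_compositions t :
  set_card [set e : {ffun 'I_n.+1 -> nat} | (\sum_i e i = t)%N] = 'C(t + n, n).
Proof.
rewrite addnC -card_ord_partitions.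
pose A := [set tp : n.+1.-tuple 'I_t.+1 | (\sum_(i <- tp) i == t)%N]%SET.
pose f (tp : n.+1.-tuple 'I_t.+1) : {ffun 'I_n.+1 -> nat} := [ffun i => val (tnth tp i)].
rewrite -/A cardE.
rewrite -(@set_card_seq _ [set tp | tp \in A] (enum A)) ?enum_uniq //; last first.
  by move=> tp; rewrite mem_enum.
rewrite -(@set_card_image _ _ f) //.
- congr set_card; apply/seteqP; split=> [e /= eE|_ [tp tpA <-]] /=.
    have et i : (e i < t.+1)%N by rewrite ltnS -eE (bigD1 i) //= leq_addr.
    have fE : f [tuple Ordinal (et i) | i < n.+1] = e.
      by apply/ffunP => i; rewrite ffunE tnth_mktuple.
    exists [tuple Ordinal (et i) | i < n.+1] => //=.
    rewrite inE big_tuple; apply/eqP; rewrite -[RHS]eE; apply: eq_bigr => i _.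
    by rewrite tnth_mktuple.
  by move: tpA => /=; rewrite inE big_tuple => /eqP <-; apply: eq_bigr => i _; rewrite ffunE.
- move=> tp tp' _ _ e; apply: eq_from_tnth => i; apply: val_inj.
  by have := congr1 (fun g : {ffun _ -> _} => g i) e; rewrite !ffunE.
Qed.

(** The binomial coefficient [C(t + n, n)] as a polynomial in [t], factored so that its zeros
    [-1, ..., -n] are visible. *)
Definition bin_poly : {poly rat} :=
  (n`!)%:R^-1 *: \prod_(j < n) ('X + (j.+1)%:R%:P).

Lemma bin_poly_nat t : bin_poly.[t%:R] = 'C(t + n, n)%:R.
Proof.
have fact0 : (n`!)%:R != 0 :> rat by rewrite pnatr_eq0 -lt0n fact_gt0.
apply: (mulIf fact0); rewrite -natrM bin_ffact hornerZ mulrAC mulVf // mul1r.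
rewrite horner_prod.
elim: n => [|k IH]; first by rewrite big_ord0 ffactn0.
rewrite big_ord_recr /= IH addnS ffactSS natrM mulrC hornerD hornerX hornerC.
by rewrite -natrD addnS.
Qed.

Lemma bin_poly_neg (t : int) : - n%:Z <= t -> t < 0 -> bin_poly.[t%:~R] = 0.
Proof.
move=> tn t0; have [j [jn tE]] : exists j, (j < n)%N /\ t = - (j.+1)%:Z.
  by exists (`|t|.-1)%N; split; lia.
rewrite hornerZ horner_prod (bigD1 (Ordinal jn)) //= hornerD hornerX hornerC.
by rewrite tE mulrNz -pmulrn addNr mul0r mulr0.
Qed.

Let M := (\prod_i d i)%N.
Let k i := (M %/ d i)%N.

Lemma M_gt0 : (0 < M)%N. Proof. by rewrite prodn_gt0. Qed.

Lemma dk i : (d i * k i = M)%N.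
Proof. by rewrite mulnC divnK // /M (bigD1 i) //= dvdn_mulr. Qed.

Lemma k_gt0 i : (0 < k i)%N.
Proof. by have := M_gt0; rewrite -(dk i) muln_gt0 => /andP[]. Qed.

Definition residues := [pred r : {ffun 'I_n.+1 -> 'I_M} | [forall i, (r i < k i)%N]].

Definition rsum (r : {ffun 'I_n.+1 -> 'I_M}) := (\sum_i d i * r i)%N.

(** The source of the vanishing at negative arguments: if [- sum d < t < 0], then a quotient
    [(t - rsum r) / M] is negative and larger than [- (n + 1)], so it is a zero of [bin_poly] when
    integral. *)
Lemma rsum_lt r : residues r -> (rsum r + \sum_i d i <= n.+1 * M)%N.
Proof.
move=> /forallP rk; rewrite /rsum -big_split /=.
rewrite -[X in (_ <= X * _)%N]card_ord -sum_nat_const; apply: leq_sum => i _.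
rewrite -mulnSr; apply: (@leq_trans (d i * k i)); last by rewrite dk.
by rewrite leq_mul2l rk orbT.
Qed.

(* Splitting [x i = k i * e i + r i] with [d i * k i = M] independent of [i]
   reduces the equation to [M * \sum_i e i = q - rsum r]. *)
Lemma card_solutions q : set_card (solutions q) = (\sum_(r | residues r)
  (if (rsum r <= q) && (M %| q - rsum r) then 'C((q - rsum r) %/ M + n, n) else 0))%N.
Proof.
have kM i : (k i <= M)%N by rewrite leq_div.
pose f (x : {ffun 'I_n.+1 -> nat}) : {ffun 'I_n.+1 -> 'I_M} :=
  [ffun i => Ordinal (leq_trans (ltn_pmod (x i) (k_gt0 i)) (kM i))].
rewrite (set_card_partition f (solutions_finite q)) [RHS]big_mkcond.
apply: eq_bigr => r _.
have fP x : solutions q x -> f x = r ->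
    residues r /\ (q = M * (\sum_i x i %/ k i) + rsum r)%N.
  move=> xq xr; have ri i : (r i = x i %% k i :> nat)%N by rewrite -xr ffunE.
  split; first by apply/forallP => i; rewrite ri ltn_pmod ?k_gt0.
  rewrite big_distrr -big_split -xq /=; apply: eq_bigr => i _.
  rewrite ri -(dk i) -mulnA -mulnDr mulnC [in X in (X * _)%N](divn_eq (x i) (k i)).
  by rewrite mulnC [(k i * _)%N]mulnC.
have nonempty0 : ~ (exists x, solutions q x /\ f x = r) ->
    set_card (solutions q `&` [set x | f x = r]) = 0%N.
  move=> no; rewrite (_ : _ `&` _ = set0) ?/set_card ?fset_set0 //.
  by apply/seteqP; split=> x // [? ?]; apply: no; exists x.
case: ifPn => [rr|nr]; last first.
  by apply: nonempty0 => -[x [xq /(fP _ xq)[rr _]]]; rewrite rr in nr.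
case: ifPn => [/andP[rq dv]|nc]; last first.
  apply: nonempty0 => -[x [xq /(fP _ xq)[_ qE]]]; move/negP: nc; apply.
  by rewrite qE leq_addl addnK dvdn_mulr.
pose g (e : {ffun 'I_n.+1 -> nat}) : {ffun 'I_n.+1 -> nat} :=
  [ffun i => k i * e i + r i]%N.
rewrite -card_compositions -(@set_card_image _ _ g [set e | (\sum_i e i = (q - rsum r) %/ M)%N]).
- congr set_card; apply/seteqP; split=> [x [xq xr]|_ [e /= eE <-]].
    have [_ qE] := fP x xq xr.
    exists [ffun i => x i %/ k i]%N.
      rewrite /= qE addnK mulKn ?M_gt0 //; apply: eq_bigr => i _; exact: ffunE.
    apply/ffunP => i; rewrite !ffunE -xr ffunE /= mulnC.
    by rewrite -divn_eq.
  split; rewrite /weighted_solutions /=.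
    under eq_bigr do rewrite ffunE mulnDr mulnA dk.
    by rewrite big_split -big_distrr /= eE mulnC divnK // subnK.
  apply/ffunP => i; apply: val_inj; rewrite !ffunE /= mulnC modnMDl modn_small //.
  exact: (forallP rr).
- apply: (@bounded_finite ((q - rsum r) %/ M)) => e i /= <-.
  by rewrite (bigD1 i) //= leq_addr.
- move=> e e' _ _ ee'; apply/ffunP => i.
  have := congr1 (fun h : {ffun _ -> _} => h i) ee'; rewrite !ffunE => /addIn/eqP.
  by rewrite eqn_pmul2l ?k_gt0 // => /eqP.
Qed.

(** The constituent for the residue class of [a] modulo [M], on which alone the divisibility test
    depends. *)
Definition ehrhart_poly (a : int) : {poly rat} :=
  \sum_(r | residues r) if (M%:Z %| a - (rsum r)%:Z)%Z
    then bin_poly \Po ((M%:R)^-1 *: ('X - (rsum r)%:R%:P)) else 0.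

Definition ehrhart_fun (t : int) : rat := (ehrhart_poly (t %% M%:Z)%Z).[t%:~R].

Lemma ehrhart_fun_quasi : quasi_polynomial ehrhart_fun.
Proof. by exists M; [exact: M_gt0|exists ehrhart_poly]. Qed.

Lemma ehrhart_funE (t : int) : - (\sum_i d i)%N%:Z < t ->
  ehrhart_fun t = if t is Posz q then (set_card (solutions q))%:R else 0.
Proof.
move=> tD; have M0 := M_gt0.
have M0' : M%:R != 0 :> rat by rewrite pnatr_eq0 -lt0n.
have term r : residues r ->
    (if (M%:Z %| (t %% M%:Z)%Z - (rsum r)%:Z)%Z
     then bin_poly \Po ((M%:R)^-1 *: ('X - (rsum r)%:R%:P)) else 0).[t%:~R] =
    if t is Posz q then
      (if (rsum r <= q)%N && (M %| q - rsum r)%N then 'C((q - rsum r) %/ M + n, n) else 0%N)%:R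
    else 0.
  move=> rr; have rl := rsum_lt rr.
  have -> : (M%:Z %| (t %% M%:Z)%Z - (rsum r)%:Z)%Z = (M%:Z %| t - (rsum r)%:Z)%Z.
    have -> : t - (rsum r)%:Z = (t %/ M)%Z * M%:Z + ((t %% M)%Z - (rsum r)%:Z).
      by rewrite addrA -divz_eq.
    by rewrite [RHS]rpredDl //; exact: dvdz_mull.
  case: ifP => [/dvdzP[j jE]|nd]; last first.
    rewrite horner0; case: t tD nd => // q _ nd.
    case: ifP => // /andP[rq dv]; move/negP: nd; case.
    by rewrite subzn // dvdzE.
  rewrite horner_comp [((M%:R)^-1 *: _).[_]]hornerZ hornerXsubC.
  have -> : (M%:R)^-1 * (t%:~R - (rsum r)%:R) = j%:~R :> rat.
    have -> : t%:~R - (rsum r)%:R = (j * M%:Z)%:~R :> rat by rewrite -jE intrB.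
    by rewrite intrM -pmulrn mulrCA mulVf // mulr1.
  (* A negative quotient is a zero of [bin_poly]. This covers negative [t] and also the terms with
     [q < rsum r], which the count omits. *)
  have [j0|j0] := ltP j 0.
    rewrite bin_poly_neg //.
      case: t tD jE => // q _ jE; case: ifP => // /andP[rq _]; exfalso.
      by nia.
    by nia.
  case: j j0 jE => // j _ jE; case: t tD jE => q; last by nia.
  rewrite bin_poly_nat => _ jE.
  have qE : q = (j * M + rsum r)%N by lia.
  by rewrite qE leq_addl addnK dvdn_mull // mulnK.
rewrite /ehrhart_fun /ehrhart_poly horner_sum (eq_bigr _ term).
case: t {tD term} => [q|q]; last by rewrite big1.
by rewrite card_solutions natr_sum.
Qed.

Lemma card_positive_solutions (P : pred 'I_n.+1) q :
  set_card [set x | solutions q x /\ forall i, P i -> (0 < x i)%N] =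
    if (\sum_(i | P i) d i <= q)%N then set_card (solutions (q - \sum_(i | P i) d i))
    else 0%N.
Proof.
have sumP (x : {ffun 'I_n.+1 -> nat}) :
    (\sum_i d i * (x i + P i) = \sum_i d i * x i + \sum_(i | P i) d i)%N.
  under eq_bigr do rewrite mulnDr.
  rewrite big_split /= [X in (_ = _ + X)%N]big_mkcond; congr (_ + _)%N; apply: eq_bigr => i _.
  by case: (P i); rewrite ?muln1 ?muln0.
pose sh (x : {ffun 'I_n.+1 -> nat}) : {ffun 'I_n.+1 -> nat} := [ffun i => x i + P i]%N.
have shE x : solutions q x -> (forall i, P i -> (0 < x i)%N) ->
    exists2 y, x = sh y & (q = \sum_i d i * y i + \sum_(i | P i) d i)%N.
  move=> xq xP; pose y := [ffun i => x i - P i]%N.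
  have xE i : (x i = y i + P i)%N.
    by rewrite ffunE; case: (boolP (P i)) => [/xP|] /=; lia.
  exists y; first by apply/ffunP => i; rewrite [RHS]ffunE.
  by rewrite -xq -sumP; apply: eq_bigr => i _; rewrite xE.
case: leqP => [le|lt]; last first.
  rewrite (_ : [set x | _] = set0) ?/set_card ?fset_set0 //.
  apply/seteqP; split=> x // [xq xP]; have [y _ qE] := shE x xq xP.
  by move: lt; rewrite qE ltnNge leq_addl.
rewrite -(@set_card_image _ _ sh (solutions (q - \sum_(i | P i) d i))).
- congr set_card; apply/seteqP; split=> [x [xq xP]|_ [y yq <-]].
    have [y xE qE] := shE x xq xP; exists y; rewrite // qE addnK //.
  split=> [|i Pi]; last by rewrite ffunE Pi addn1.
  rewrite /weighted_solutions /=; under eq_bigr do rewrite ffunE.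
  by rewrite sumP yq subnK.
- exact: solutions_finite.
- move=> y y' _ _ e; apply/ffunP => i.
  by have := congr1 (fun h : {ffun _ -> _} => h i) e; rewrite !ffunE => /addIn.
Qed.

End CountingSolutions.

(** Fix [t]. The difference of the two constituents used at [t] vanishes at all positive integers
    congruent to [t] modulo [n1 * n2], which are too many for a nonzero polynomial. *)
Lemma quasi_polynomial_eq (g1 g2 : int -> rat) :
  quasi_polynomial g1 -> quasi_polynomial g2 ->
  (forall q : nat, (0 < q)%N -> g1 q%:Z = g2 q%:Z) -> g1 = g2.
Proof.
move=> [n1 n1_gt0 [p1 h1]] [n2 n2_gt0 [p2 h2]] e; apply/funext => t.
pose P := p1 (t %% n1)%Z - p2 (t %% n2)%Z.
pose y k : int := t + (n1 * n2 * (k + `|t|.+1))%N%:Z.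
suff P0 : P = 0 by apply/eqP; rewrite -subr_eq0 h1 h2 -hornerN -hornerD -/P P0 horner0.
apply: (@roots_geq_poly_eq0 _ _ [seq (y k)%:~R | k <- iota 0 (size P)]).
- apply/allP => _ /mapP[k _ ->]; rewrite /root hornerD hornerN subr_eq0.
  have y0 : 0 < y k.
    have n12 : (0 < n1 * n2)%N by rewrite muln_gt0 n1_gt0.
    have := leq_pmull (k + `|t|.+1) n12; rewrite /y; lia.
  have m1 : (y k %% n1 = t %% n1)%Z.
    by rewrite /y -mulnA PoszM mulrC addrC modzMDl.
  have m2 : (y k %% n2 = t %% n2)%Z.
    by rewrite /y mulnAC PoszM addrC modzMDl.
  by rewrite -m1 -h1 -m2 -h2; case: (y k) y0 => // q q0; apply/eqP/e.
- rewrite map_inj_in_uniq ?iota_uniq // => a b _ _ /intr_inj /addrI [] /eqP.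
  by rewrite eqn_pmul2l ?muln_gt0 ?n1_gt0 // eqn_add2r => /eqP.
- by rewrite size_map size_iota.
Qed.

(** * The Worpitzky partition *)

Section Worpitzky.
Context (R : realType) (l : nat) (Phi : {fset 'rV[R]_l})
  (alpha : 'I_l -> 'rV[R]_l) (c : 'I_l -> nat) {RD : root_data Phi alpha c}.
Implicit Types (b u : 'rV[R]_l) (m : int) (w : 'rV[R]_l -> 'rV[R]_l).

Local Notation bs := (ext_simple alpha c).
Local Notation lam := (bary alpha c).
Local Notation in_alcove := (in_alcove alpha c).
Local Notation W := (weyl_group Phi).
Local Notation Q := (coroot_lattice alpha).
Local Notation Z := (coweight_lattice alpha).
Local Notation solutions := (weighted_solutions (ext_coef c)).
Local Notation pos := (positive_roots Phi alpha).

(** An element is determined by the images of the simple roots, which lie in the finite set of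
    roots. *)
Lemma weyl_finite : finite_set W.
Proof.
pose F (f : {ffun 'I_l -> Phi}) (x : 'rV[R]_l) : 'rV[R]_l :=
  \sum_i dot x (coweight alpha i) *: val (f i).
apply: (@sub_finite_set _ _ (range F)); last exact: finite_image.
move=> w Ww; exists [ffun i => FSetSub (weyl_root Ww (simple_root i))] => //.
apply/funext => x; rewrite {2}(simple_expand x) /F.
have -> : w (\sum_i dot x (coweight alpha i) *: alpha i) =
    \sum_i w (dot x (coweight alpha i) *: alpha i).
  by apply: (big_morph w) => [u v|]; [rewrite (weylD _ _ Ww)|rewrite (weyl0 Ww)].
by apply: eq_bigr => i _; rewrite (weylZ _ _ Ww) ffunE.
Qed.

Lemma posP b : reflect (b \in Phi /\ exists n, b = nat_comb alpha n) (b \in pos).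
Proof.
rewrite !inE /=; apply: (iffP andP) => -[bP h]; split=> //; first exact/asboolP.
exact/asboolP.
Qed.

Lemma pos_root b : b \in pos -> b \in Phi.
Proof. by move=> /posP[]. Qed.

Lemma root_pos b : b \in Phi -> (b \in pos) || (- b \in pos).
Proof.
move=> bP; have [_ _ /(_ _ bP)[n [e|e]]] := @rd_simple _ _ _ _ _ RD.
  by apply/orP; left; apply/posP; split=> //; exists n.
apply/orP; right; apply/posP; split; first exact: root_opp.
by exists n; rewrite e opprK.
Qed.

Lemma pos_height b : b \in pos -> 0 < dot b (\sum_i coweight alpha i).
Proof.
move=> /posP[bP [n e]]; rewrite dot_sumr lt0r.
have E i : dot b (coweight alpha i) = (n i)%:R by rewrite e int_comb_coweight.
under eq_bigr do rewrite E.
rewrite sumr_ge0 // andbT; apply/negP; rewrite psumr_eq0 // => /allP n0.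
have b0 : b != 0 by exact: root_neq bP.
move/negP: b0; apply; apply/eqP; rewrite (simple_expand b) big1 // => i _.
have /implyP/(_ isT)/eqP := n0 i (mem_index_enum _).
by rewrite E => ->; rewrite scale0r.
Qed.

Lemma pos_opp b : b \in pos -> - b \notin pos.
Proof.
move=> /pos_height b0; apply/negP => /pos_height.
by rewrite dotNl oppr_gt0 ltNge ltW.
Qed.

Lemma pos_oppE b : b \in Phi -> (- b \in pos) = (b \notin pos).
Proof.
move=> bP; apply/idP/idP => [nb|/negbTE nb].
  by rewrite -(opprK b) pos_opp.
by have := root_pos bP; rewrite nb.
Qed.

Lemma seq_lower_bound (T : eqType) (s : seq T) (F : T -> R) :
  (forall y, y \in s -> 0 < F y) -> exists2 t, 0 < t & forall y, y \in s -> t < F y.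
Proof.
elim: s => [|z s IH] h; first by exists 1.
have [|t t0 ht] := IH; first by move=> y ys; apply: h; rewrite inE ys orbT.
have Fz := h z (mem_head _ _).
exists (Num.min t (F z / 2)); first by rewrite lt_min t0 divr_gt0.
move=> y; rewrite inE => /predU1P[->|/ht ty]; rewrite gt_min; last by rewrite ty.
by apply/orP; right; lra.
Qed.

(* Moving [x] slightly into the antidominant direction decides on which side of
   each hyperplane through [x] it belongs. *)
Lemma perturb x : exists p, [/\ regular Phi p,
  forall b m, b \in pos -> (0 < aff b m p) = (0 < aff b m x) &
  forall b m, - b \in pos -> (0 < aff b m p) = (0 <= aff b m x)].
Proof.
pose rho : 'rV[R]_l := \sum_i coweight alpha i.
(* Distance from [dot b x] down to the next integer strictly below; a shorter descent meets no new
   hyperplane of [b]. *)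
pose low b := dot b x - (Num.ceil (dot b x) - 1)%:~R.
have [b bp|t t0 ht] := @seq_lower_bound _ pos (fun b => low b / dot b rho).
  by rewrite divr_gt0 ?(pos_height bp) // subr_gt0 ceilB1_lt.
pose p := x - t *: rho.
have pE b : dot b p = dot b x - t * dot b rho by rewrite dotBr dotZr.
have lo b : b \in pos -> (Num.ceil (dot b x) - 1)%:~R < dot b p.
  move=> bp; have := ht _ bp; rewrite ltr_pdivlMr ?(pos_height bp) // /low pE; lra.
have hi b : b \in pos -> dot b p < dot b x.
  by move=> bp; rewrite pE gtrBl mulr_gt0 ?(pos_height bp).
have side b m : b \in pos -> (dot b p < m%:~R) = (dot b x <= m%:~R).
  move=> bp; apply/idP/idP => [|h]; last exact: lt_le_trans (hi _ bp) h.
  by move=> /(lt_trans (lo _ bp)); rewrite ltr_int ltrBlDr ltzD1 ceil_le_int.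
have side' b m : b \in pos -> (m%:~R < dot b p) = (m%:~R < dot b x).
  move=> bp; apply/idP/idP => [h|]; first exact: lt_trans h (hi _ bp).
  rewrite -(ceil_gt_int (dot b x)) => h; apply: le_lt_trans (lo _ bp).
  by rewrite ler_int -ltzD1 subrK.
have neg b m y : aff b m y = m%:~R - dot (- b) y by rewrite /aff dotNl opprK addrC.
have pos' b m y : aff b m y = dot b y - (- m)%:~R by rewrite /aff intrN opprK.
exists p; split=> [b m bP|b m bp|b m bp].
- have reg d k : d \in pos -> aff d k p != 0.
    move=> dp; rewrite pos' subr_eq0; apply/eqP => e.
    have := side d (- k) dp; rewrite -{1}e ltxx => /esym/negbT.
    by rewrite -ltNge -side' // e ltxx.
  have [bp|bp] := orP (root_pos bP); first exact: reg.
  by rewrite -oppr_eq0 -aff_opp reg.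
- by rewrite !pos' !subr_gt0 side'.
- by rewrite !neg subr_gt0 subr_ge0 side.
Qed.

(** The coweight in the dilated alcove with coordinates [x]; the entry [x ord0] is recovered from
    the equation. *)
Definition sol_point (x : {ffun 'I_l.+1 -> nat}) : 'rV[R]_l :=
  \sum_i (x (lift ord0 i))%:R *: coweight alpha i.

Lemma dot_sol_point i x : dot (alpha i) (sol_point x) = (x (lift ord0 i))%:R.
Proof.
rewrite dot_sumr (bigD1 i) //= dotZr dot_coweight eqxx mulr1 big1 ?addr0 // => j ji.
by rewrite dotZr dot_coweight eq_sym (negbTE ji) mulr0.
Qed.

Lemma sol_point_coweight x : Z (sol_point x).
Proof. by move=> i; rewrite dot_sol_point natr_int. Qed.

Lemma lam_sol_point q x i : (0 < q)%N -> solutions q x ->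
  lam i (q%:R^-1 *: sol_point x) = (x i)%:R / q%:R.
Proof.
move=> q0 xq; have q0' : q%:R != 0 :> R by rewrite pnatr_eq0 -lt0n.
case: (unliftP ord0 i) => [j|] ->.
  by rewrite lam_liftE dotZr dot_sol_point mulrC.
rewrite lam0E dotZr dot_nat_comb.
under eq_bigr do rewrite dot_sol_point.
have /(congr1 (fun n => n%:R : R)) := xq.
rewrite big_ord_recl ext_coef0 mul1n natrD => e.
have -> : (x ord0)%:R = q%:R - \sum_(i < l) (c i)%:R * (x (lift ord0 i))%:R :> R.
  rewrite -e natr_sum; under [X in _ + X - _]eq_bigr do rewrite ext_coef_lift natrM.
  by rewrite addrK.
by rewrite mulrBl mulfV // [in RHS]mulrC.
Qed.

Lemma sol_point_inj q x x' : (0 < q)%N -> solutions q x -> solutions q x' ->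
  sol_point x = sol_point x' -> x = x'.
Proof.
move=> q0 xq xq' e; apply/ffunP => i.
have := lam_sol_point i q0 xq; rewrite e lam_sol_point // => /eqP.
by rewrite (inj_eq (divIf _)) ?pnatr_eq0 -?lt0n // eqr_nat eq_sym => /eqP.
Qed.

(* The pullback of the partial closure of the alcove [w A + g]. *)
Definition half_open w u :=
  forall i, 0 <= lam i u /\ (w (bs i) \in pos -> 0 < lam i u).

Lemma aff_weyl w g b m : W w -> Z g -> b \in Phi -> exists k : int,
  forall u, aff b m u = aff (w b) k (w u + g).
Proof.
move=> Ww Zg bP; have [k e] := coweight_int (weyl_root Ww bP) Zg.
exists (m - k) => v; rewrite /aff dotDr weyl_dot // e intrB; ring.
Qed.

(** For [p] a perturbation of [x]: [p] is in the open alcove exactly when [x] is in its partial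
    closure, positive walls staying strict and negative ones becoming weak. *)
Lemma half_openP w g x p u u' : W w -> Z g ->
  (forall b m, b \in pos -> (0 < aff b m p) = (0 < aff b m x)) ->
  (forall b m, - b \in pos -> (0 < aff b m p) = (0 <= aff b m x)) ->
  x = w u + g -> p = w u' + g -> in_alcove u' <-> half_open w u.
Proof.
move=> Ww Zg hp hn xE pE.
suff E i : 0 < lam i u' <-> 0 <= lam i u /\ (w (bs i) \in pos -> 0 < lam i u).
  by split=> h i; [apply/E|apply/E].
have bP : w (bs i) \in Phi by exact: weyl_root Ww (bs_root i).
have [k hk] := aff_weyl (level i) Ww Zg (bs_root i).
rewrite /bary !hk -xE -pE; have [bp|bn] := boolP (w (bs i) \in pos).
  by rewrite hp //; split=> [h|[_ /(_ isT)]//]; split=> //; exact: ltW.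
by rewrite hn ?pos_oppE //; split=> [h|[]//]; split.
Qed.

Definition coset (g : 'rV[R]_l) := [set g + y | y in Q].

Lemma coset_eq g g' : coset g = coset g' <-> Q (g - g').
Proof.
split=> [e|h].
  have : coset g g by exists 0; rewrite ?addr0 //; exact: coroot_lattice0.
  by rewrite e => -[y Qy <-]; rewrite addrAC subrr add0r.
apply/seteqP; split=> _ [y Qy <-].
  by exists (g - g' + y); [exact: coroot_latticeD|rewrite addrA subrKC].
by exists (y - (g - g')); [exact: coroot_latticeB|rewrite addrCA subKr addrC].
Qed.

(* The translation parts of the elements of the extended affine Weyl group that
   move the fundamental alcove to the one containing [p] form a set of
   representatives of [Z / Q]. *)
Lemma alcove_coset p k : regular Phi p -> Z k -> exists w g u,
  [/\ W w, Z g, in_alcove u, p = w u + g & coset g = coset k].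
Proof.
move=> rp Zk.
have rpk : regular Phi (p - k).
  move=> b m bP; have [n e] := coweight_int bP Zk.
  by have := rp b (m - n) bP; rewrite /aff intrB -e dotBr addrCA addrC.
have [w [g [u [Ww Qg uA e]]]] := alcove_cover rpk.
exists w, (g + k), u; split => //.
- by apply: coweight_latticeD => //; exact: coroot_coweight.
- by rewrite addrA -e subrK.
- by apply/coset_eq; rewrite addrK.
Qed.

(** Subtracting [g'] leaves the translation parts [g - g'] and 0, both in the coroot lattice, where
    the action is free. *)
Lemma alcove_coset_unique w w' g g' u u' : W w -> W w' -> Z g -> Z g' ->
  in_alcove u -> in_alcove u' -> w u + g = w' u' + g' -> coset g = coset g' ->
  w = w' /\ g = g'.
Proof.
move=> Ww Ww' Zg Zg' uA uA' e /coset_eq Qgg'.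
have [|-> /eqP] := alcove_unique Ww Ww' Qgg' (coroot_lattice0 alpha) uA uA' _.
  by rewrite addr0 addrA e addrK.
by rewrite subr_eq0 => /eqP.
Qed.

Definition dominated w (x : {ffun 'I_l.+1 -> nat}) :=
  [forall i, (w (bs i) \in pos) ==> (0 < x i)%N].

Lemma half_open_sol_point q w x : (0 < q)%N -> solutions q x ->
  half_open w (q%:R^-1 *: sol_point x) <-> dominated w x.
Proof.
move=> q0 xq; split=> [h|/forallP h i].
  apply/forallP => i; apply/implyP => wi; have [_ /(_ wi)] := h i.
  by rewrite lam_sol_point // pmulr_lgt0 ?invr_gt0 ltr0n.
rewrite lam_sol_point // divr_ge0 //; split => // wi.
by rewrite divr_gt0 ?ltr0n //; have := h i; rewrite wi.
Qed.

Definition congruent (q : nat) (y z : 'rV[R]_l) := exists2 g, Z g & y + q%:R *: g = z.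

(** A pair is sent to the coset of its translation part [tr]. This is a bijection onto [Z / Q],
    since in each coset exactly one alcove contains the perturbed point [p]. *)
Lemma card_alcove_points q z : (0 < q)%N -> Z z ->
  (\sum_(w <- fset_set W) \sum_(x <- fset_set (solutions q))
     (dominated w x && `[< congruent q (w (sol_point x)) z >]))%N =
  connection_index alpha.
Proof.
move=> q0 Zz; have q0' : q%:R != 0 :> R by rewrite pnatr_eq0 -lt0n.
rewrite (sum_pairs _ weyl_finite (solutions_finite (ext_coef_gt0 (c := c)) q)).
set S := [set p | _].
pose tr (p : ('rV[R]_l -> 'rV[R]_l) * {ffun 'I_l.+1 -> nat}) : 'rV[R]_l :=
  q%:R^-1 *: (z - p.1 (sol_point p.2)).
have trP p g : p.1 (sol_point p.2) + q%:R *: g = z -> tr p = g.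
  by move=> e; rewrite /tr -e addrAC subrr add0r scalerA mulVf // scale1r.
have trE p g : W p.1 -> tr p = g -> q%:R^-1 *: z = p.1 (q%:R^-1 *: sol_point p.2) + g.
  by move=> Wp <-; rewrite (weylZ _ _ Wp) /tr scalerBr subrKC.
have [p [rp hp hn]] := perturb (q%:R^-1 *: z).
have fS : finite_set S.
  apply: (@sub_finite_set _ _ (W `*` solutions q)); first by move=> ab [].
  by apply: finite_setX; [exact: weyl_finite|apply: solutions_finite; exact: ext_coef_gt0].
have SP ab : S ab -> exists u, [/\ W ab.1, Z (tr ab), in_alcove u & p = ab.1 u + tr ab].
  case: ab => w x [/= Ww xq /andP[dom /asboolP[g Zg /(trP (w, x)) trg]]].
  have [v [Wv wv vw]] := weyl_inv Ww.
  exists (v (p - g)); rewrite trg; split => //; last by rewrite vw subrK.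
  apply/(half_openP Ww Zg hp hn (trE (w, x) g Ww trg)); first by rewrite vw subrK.
  exact/half_open_sol_point.
rewrite -(@set_card_image _ _ (coset \o tr)) //; last first.
  move=> [w x] [w' x'] /set_mem Swx /set_mem Swx' /=.
  have [u [/= Ww Zg uA pE]] := SP _ Swx; have [u' [/= Ww' Zg' uA' pE']] := SP _ Swx'.
  move=> /(alcove_coset_unique Ww Ww' Zg Zg' uA uA')[|ww' /(scalerI (invr_neq0 q0'))].
    by rewrite -pE.
  move=> /addrI/oppr_inj; subst w' => /= e.
  have [v [Wv wv vw]] := weyl_inv Ww.
  congr pair; apply: (sol_point_inj q0); [by case: Swx|by case: Swx'|].
  exact: (can_inj wv).
rewrite /connection_index; congr set_card; apply/seteqP; split.
  by move=> _ [ab /SP[u [_ Zg _ _]] <-]; exists (tr ab).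
move=> _ [k Zk <-].
have [w [g [u [Ww Zg uA pE /esym kE]]]] := alcove_coset rp Zk.
have [v [Wv wv vw]] := weyl_inv Ww.
pose u0 := v (q%:R^-1 *: z - g).
have u0E : q%:R^-1 *: z = w u0 + g by rewrite vw subrK.
have ho : half_open w u0 by apply/(half_openP Ww Zg hp hn u0E pE).
(* Both [z] and [g] are coweights, so the dilated coordinates are integers; the partial closure
   makes them nonnegative. *)
have int_lam i : exists n : nat, q%:R * lam i u0 = n%:R.
  have [m hm] := aff_weyl (level i) Ww Zg (bs_root i).
  have [n e] := coweight_int (weyl_root Ww (bs_root i)) Zz.
  have E : q%:R * lam i u0 = (n + m *+ q)%:~R.
    by rewrite /bary hm -u0E /aff dotZr e mulrDr mulVKf // intrD mulr_natl rmorphMn.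
  have : 0 <= q%:R * lam i u0 by rewrite mulr_ge0 //; case: (ho i).
  by rewrite E ler0z; case: (n + m *+ q) => // k' _; exists k'.
pose x := [ffun i => sval (cid (int_lam i))].
have xE i : q%:R * lam i u0 = (x i)%:R by rewrite ffunE; case: cid.
have xq : solutions q x.
  apply/eqP; rewrite -(eqr_nat R) natr_sum; under eq_bigr do rewrite natrM -xE mulrCA.
  by rewrite -mulr_sumr sum_lam mulr1.
have ptE : sol_point x = q%:R *: u0.
  rewrite [RHS](coweight_expand (q%:R *: u0)); apply: eq_bigr => i _.
  by rewrite dotZr -(lam_liftE alpha c) xE.
have cong : w (sol_point x) + q%:R *: g = z.
  by rewrite ptE (weylZ _ _ Ww) -scalerDr -u0E scalerA mulfV // scale1r.
exists (w, x); last by rewrite /= (trP (w, x) g cong).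
split=> //=; apply/andP; split; last by apply/asboolP; exists g.
apply/(half_open_sol_point _ q0 xq).
by rewrite ptE scalerA mulVf // scale1r.
Qed.

End Worpitzky.

(** * The Ehrhart quasi-polynomial *)

Section Ehrhart.
Context (R : realType) (l : nat) (Phi : {fset 'rV[R]_l})
  (alpha : 'I_l -> 'rV[R]_l) (c : 'I_l -> nat) {RD : root_data Phi alpha c}.

Local Notation bs := (ext_simple alpha c).
Local Notation lam := (bary alpha c).
Local Notation in_alcove := (in_alcove alpha c).
Local Notation solutions := (weighted_solutions (ext_coef c)).

Lemma fundamental_alcoveP x : fundamental_alcove alpha c x <-> in_alcove x.
Proof.
have lam0 : (0 < lam ord0 x) = (-1 < dot (bs ord0) x).
  by rewrite lam0E bs0 dotNl ltrN2 subr_gt0.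
split=> [[h h0] i|h]; last first.
  by split=> [i|]; [rewrite -(lam_liftE alpha c)|rewrite -lam0].
by case: (unliftP ord0 i) => [j|] ->; rewrite ?lam_liftE ?lam0.
Qed.

Lemma dot_continuous (b : 'rV[R]_l) : continuous (dot b).
Proof.
suff h r : continuous (fun v : 'rV[R]_l => \sum_(i <- r) b 0 i * v 0 i) by exact: h.
elim: r => [|i r IH].
  rewrite (_ : (fun v => _) = fun=> 0); last by apply/funext => v; rewrite big_nil.
  by move=> x; exact: cst_continuous.
rewrite (_ : (fun v => _) =
    fun v : 'rV[R]_l => b 0 i * v 0 i + \sum_(j <- r) b 0 j * v 0 j); last first.
  by apply/funext => v; rewrite big_cons.
move=> x; apply: (@continuousD R R^o _ (fun v : 'rV[R]_l => b 0 i * v 0 i)); last exact: IH.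
by apply: continuousM; [exact: cst_continuous|exact: coord_continuous].
Qed.

Lemma aff_continuous (b : 'rV[R]_l) m : continuous (aff b m).
Proof. by move=> x; apply: continuousD; [exact: dot_continuous|exact: cst_continuous]. Qed.

Lemma lam_segment i (t : R) u v : lam i (u + t *: (v - u)) = (1 - t) * lam i u + t * lam i v.
Proof. by rewrite /bary /aff dotDr dotZr dotBr; ring. Qed.

(** A point with nonnegative coordinates is approached along the segment from an interior point. *)
Lemma closure_alcoveP x :
  closure (fundamental_alcove alpha c) x <-> forall i, 0 <= lam i x.
Proof.
split=> [clx i|h].
  have cl : closed [set y | 0 <= lam i y].
    apply: (@closed_comp _ _ (lam i) [set z | 0 <= z]); last exact: closed_ge.
    by move=> y _; exact: aff_continuous.
  rewrite closure_id in cl; suff : closure [set y | 0 <= lam i y] x by rewrite -cl.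
  apply: closure_subset clx => y /fundamental_alcoveP yA; exact: ltW.
move=> B Bx; have [u uA] := @alcove_point _ _ _ _ _ RD.
have cont : (fun t : R => x + t *: (u - x)) @ (0 : R) --> x + (0 : R) *: (u - x).
  by apply: cvgD; [exact: cvg_cst|apply: cvgZr_tmp].
rewrite scale0r addr0 in cont.
have /nbhs_ballP[e /= e0 he] := cont _ Bx.
pose t : R := Num.min (e / 2) 2^-1.
have t0 : 0 < t by rewrite lt_min; apply/andP; split; lra.
have t1 : t <= 2^-1 by rewrite ge_min lexx orbT.
exists (x + t *: (u - x)); split; last first.
  apply: he; rewrite /ball /= sub0r normrN gtr0_norm // gt_min; apply/orP; left; lra.
apply/fundamental_alcoveP => i; rewrite lam_segment.
have := uA i; have := h i => hi ui.
by rewrite ltr_wpDl ?mulr_ge0 ?mulr_gt0 // subr_ge0; lra.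
Qed.

Lemma lattice_countE q : (0 < q)%N -> lattice_count alpha c q = set_card (solutions q).
Proof.
move=> q0; have q0' : q%:R != 0 :> R by rewrite pnatr_eq0 -lt0n.
rewrite -(@set_card_image _ _ (sol_point alpha) (solutions q)).
- congr set_card; apply/seteqP; split=> [z [[x /closure_alcoveP x0 <-] Zx]|_ [x xq <-]].
  + have int_lam i : exists n : nat, q%:R * lam i x = n%:R.
      have [k e] := coweight_int (bs_root i) Zx.
      have E : q%:R * lam i x = (k + level i *+ q)%:~R.
        by rewrite mulrDr -dotZr e intrD mulr_natl rmorphMn.
      have : 0 <= q%:R * lam i x by rewrite mulr_ge0.
      by rewrite E ler0z; case: (k + _) => // n _; exists n.
    pose y := [ffun i => sval (cid (int_lam i))].
    have yE i : q%:R * lam i x = (y i)%:R by rewrite ffunE; case: cid.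
    exists y.
      apply/eqP; rewrite -(eqr_nat R) natr_sum.
      under eq_bigr do rewrite natrM -yE mulrCA.
      by rewrite -mulr_sumr sum_lam mulr1.
    rewrite [RHS](coweight_expand (q%:R *: x)); apply: eq_bigr => i _.
    by rewrite dotZr -(lam_liftE alpha c) yE.
  + split; last exact: sol_point_coweight.
    exists (q%:R^-1 *: sol_point alpha x); last by rewrite scalerA mulfV // scale1r.
    by apply/closure_alcoveP => i; rewrite (lam_sol_point _ q0 xq) divr_ge0.
- by apply: solutions_finite; exact: ext_coef_gt0.
- by move=> x x' /set_mem xq /set_mem xq'; exact: (sol_point_inj q0).
Qed.

(** The explicit [ehrhart_fun] shows that the choice in [ehrhart] is not the default value, and
    uniqueness identifies the two. *)
Lemma ehrhartE (t : int) : - (coxeter_number c)%:Z < t ->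
  ehrhart alpha c t = if t is Posz q then (set_card (solutions q))%:R else 0.
Proof.
have ec0 : forall i, (0 < ext_coef c i)%N by exact: ext_coef_gt0.
move=> th; rewrite -(ehrhart_funE ec0) //; congr (_ t).
have G : [set g | quasi_polynomial g /\
    forall q : nat, (0 < q)%N -> g q%:Z = (lattice_count alpha c q)%:R] (ehrhart_fun (ext_coef c)).
  split=> [|q q0]; first exact: ehrhart_fun_quasi.
  rewrite lattice_countE // ehrhart_funE //; lia.
have [qp e] := xgetI (fun=> 0) G.
apply: quasi_polynomial_eq => // [|q q0]; first by case: G.
by rewrite /ehrhart e //; case: G => _ ->.
Qed.

Lemma ehrhart_positive (P : pred 'I_l.+1) q : (0 < q)%N ->
  ehrhart alpha c (q%:Z - (\sum_(i | P i) ext_coef c i)%N%:Z) =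
  (set_card [set x | solutions q x /\ forall i, P i -> (0 < x i)%N])%:R.
Proof.
have ec0 : forall i, (0 < ext_coef c i)%N by exact: ext_coef_gt0.
(* As [q] is positive, the argument stays strictly above [- h] even when [P] holds for every
   index. *)
move=> q0; rewrite card_positive_solutions // ehrhartE; last first.
  have : (\sum_(i | P i) ext_coef c i <= coxeter_number c)%N.
    by rewrite [leqRHS](bigID P) leq_addr.
  by lia.
case: leqP => h; first by rewrite subzn.
by case E : (_ - _) => //; lia.
Qed.

End Ehrhart.

(** * The formula as an equality of two sets of lattice points *)

Section ShiftOperator.
Variable (K : nzRingType).
Implicit Types (P : {poly K}) (g : int -> K).

Lemma shift_op_widen n P g t : (size P <= n)%N ->
  shift_op P g t = \sum_(k < n) P`_k * g (t - k%:Z).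
Proof.
move=> le; rewrite /shift_op (big_ord_widen n (fun k => P`_k * g (t - k%:Z))) //.
rewrite big_mkcond; apply: eq_bigr => k _; case: ltnP => // /leq_sizeP/(_ _ (leqnn _)) ->.
by rewrite mul0r.
Qed.

Lemma shift_opZ a P g t : shift_op (a *: P) g t = a * shift_op P g t.
Proof.
rewrite (shift_op_widen _ _ (size_scale_leq a P)) mulr_sumr.
by apply: eq_bigr => k _; rewrite coefZ mulrA.
Qed.

Lemma shift_opD P P' g t : shift_op (P + P') g t = shift_op P g t + shift_op P' g t.
Proof.
rewrite (shift_op_widen _ _ (size_polyD P P')).
rewrite (shift_op_widen _ _ (leq_maxl (size P) (size P'))).
rewrite (shift_op_widen _ _ (leq_maxr (size P) (size P'))) -big_split.
by apply: eq_bigr => k _; rewrite coefD mulrDl.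
Qed.

Lemma shift_op0 g t : shift_op 0 g t = 0.
Proof. by rewrite /shift_op size_poly0 big_ord0. Qed.

Lemma shift_opXn n g t : shift_op 'X^n g t = g (t - n%:Z).
Proof.
rewrite /shift_op size_polyXn big_ord_recr big1 /= ?coefXn ?eqxx ?mul1r ?add0r // => k _.
by rewrite coefXn ltn_eqF ?mul0r.
Qed.

Lemma shift_op_sum (I : Type) (r : seq I) (F : I -> {poly K}) g t :
  shift_op (\sum_(i <- r) F i) g t = \sum_(i <- r) shift_op (F i) g t.
Proof.
by apply: (big_morph (fun P => shift_op P g t)) => [P P'|]; rewrite ?shift_opD ?shift_op0.
Qed.

End ShiftOperator.

Section Formula.
Context (R : realType) (l : nat) (Phi : {fset 'rV[R]_l})
  (alpha : 'I_l -> 'rV[R]_l) (c : 'I_l -> nat) {RD : root_data Phi alpha c}.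
Variable Psi : {fset 'rV[R]_l}.
Hypothesis Psi_pos : (Psi `<=` positive_roots Phi alpha)%fset.
Implicit Types (w : 'rV[R]_l -> 'rV[R]_l) (x : {ffun 'I_l.+1 -> nat}).

Local Notation bs := (ext_simple alpha c).
Local Notation lam := (bary alpha c).
Local Notation W := (weyl_group Phi).
Local Notation Z := (coweight_lattice alpha).
Local Notation solutions := (weighted_solutions (ext_coef c)).
Local Notation pos := (positive_roots Phi alpha).
Local Notation pt := (sol_point alpha).

Definition avoids (q : nat) (y : 'rV[R]_l) :=
  forall b, b \in Psi -> ~ exists k : int, dot b y = q%:R * k%:~R.

Definition residue_point q (z : {ffun 'I_l -> 'I_q}) : 'rV[R]_l :=
  \sum_i (z i)%:R *: coweight alpha i.

Lemma dot_residue_point q (z : {ffun 'I_l -> 'I_q}) i :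
  dot (alpha i) (residue_point z) = (z i)%:R.
Proof.
rewrite dot_sumr (bigD1 i) //= dotZr dot_coweight eqxx mulr1 big1 ?addr0 // => j ji.
by rewrite dotZr dot_coweight eq_sym (negbTE ji) mulr0.
Qed.

Lemma avoids_congruent q y z : congruent alpha q y z -> avoids q y <-> avoids q z.
Proof.
move=> [g Zg <-]; split=> h b bP [k e]; apply: (h b bP);
  have /pos_root bPhi := fsubsetP Psi_pos _ bP; have [n gn] := coweight_int bPhi Zg.
  by exists (k - n); rewrite intrB mulrBr -e dotDr dotZr gn addrK.
by exists (k + n); rewrite dotDr dotZr e gn intrD mulrDr.
Qed.

Lemma avoids_residue q (z : {ffun 'I_l -> 'I_q}) : (0 < q)%N ->
  avoids q (residue_point z) <-> (forall a : 'I_l -> int, int_comb alpha a \in Psi ->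
    ~~ (q%:Z %| \sum_(i < l) a i * (z i)%:Z)%Z).
Proof.
have dotE a : dot (int_comb alpha a) (residue_point z) = (\sum_i a i * (z i)%:Z)%:~R.
  rewrite dot_int_comb rmorph_sum; apply: eq_bigr => i _.
  by rewrite dot_residue_point rmorphM.
move=> q0; split=> h.
  move=> a aP; apply/negP => /dvdzP[k e]; apply: (h _ aP); exists k.
  by rewrite dotE e intrM mulrC.
move=> b bP [k]; have /posP[_ [n bE]] := fsubsetP Psi_pos _ bP.
rewrite bE dotE => e.
have nd : ~~ (q%:Z %| \sum_(i < l) (n i)%:Z * (z i)%:Z)%Z.
  by apply: (h (fun i => (n i)%:Z)); rewrite -/(nat_comb alpha n) -bE.
move/negP: nd; apply.
by apply/dvdzP; exists k; apply: (@intr_inj R); rewrite e intrM mulrC.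
Qed.

Lemma congruent_unique q y (z z' : {ffun 'I_l -> 'I_q}) :
  congruent alpha q y (residue_point z) -> congruent alpha q y (residue_point z') -> z = z'.
Proof.
move=> [g Zg e] [g' Zg' e']; apply/ffunP => i; apply: val_inj => /=.
have /Num.Theory.intrP[k kE] := Zg i; have /Num.Theory.intrP[k' kE'] := Zg' i.
have := congr1 (dot (alpha i)) e; have := congr1 (dot (alpha i)) e'.
rewrite !dotDr !dotZr !dot_residue_point kE kE' => h h'.
have : (z i)%:Z = (z' i)%:Z + (k - k') * q%:Z.
  by apply: (@intr_inj R); rewrite intrD intrM intrB -!pmulrn -h -h'; ring.
move=> /(congr1 (fun n => n %% q%:Z)%Z); rewrite addrC modzMDl !modz_nat !modn_small //.
by case.
Qed.

Lemma congruent_exists q y : (0 < q)%N -> Z y ->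
  exists z : {ffun 'I_l -> 'I_q}, congruent alpha q y (residue_point z).
Proof.
move=> q0 Zy; have n_ i : exists n : int, dot (alpha i) y = n%:~R.
  exact/Num.Theory.intrP/Zy.
pose n i := sval (cid (n_ i)).
have nE i : dot (alpha i) y = (n i)%:~R by rewrite /n; case: cid.
have zq i : (`|n i %% q|%Z < q)%N.
  by have := ltz_pmod (n i) (_ : 0 < q%:Z); have := @modz_ge0 (n i) q%:Z; lia.
exists [ffun i => Ordinal (zq i)].
exists (- \sum_i ((n i %/ q)%Z)%:~R *: coweight alpha i) => [i|].
  rewrite dotNr rpredN dot_sumr; apply: rpred_sum => j _.
  by rewrite dotZr dot_coweight rpredM ?intr_int ?natr_int.
rewrite [LHS]coweight_expand; apply: eq_bigr => i _; congr (_ *: _).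
rewrite dotDr dotZr dotNr dot_sumr (bigD1 i) //= dotZr dot_coweight eqxx mulr1.
rewrite big1 ?addr0 => [|j ji]; last by rewrite dotZr dot_coweight eq_sym (negbTE ji) mulr0.
rewrite ffunE /= nE {1}(divz_eq (n i) q) intrD intrM -pmulrn.
rewrite [in RHS]pmulrn gez0_abs; last by rewrite modz_ge0 //; lia.
ring.
Qed.

(** Double counting: each avoiding residue is weighted by its [f] pairs, and after exchanging the
    sums each pair meets exactly one residue, [z0]. *)
Lemma chi_count q : (0 < q)%N ->
  (connection_index alpha * chi_quasi alpha Psi q =
   \sum_(w <- fset_set W) \sum_(x <- fset_set (solutions q))
     (dominated Phi alpha c w x && `[< avoids q (w (pt x)) >]))%N.
Proof.
move=> q0; rewrite /chi_quasi -sum1_card big_distrr /= big_mkcond /=.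
pose good (z : {ffun 'I_l -> 'I_q}) := `[< avoids q (residue_point z) >].
transitivity (\sum_z \sum_(w <- fset_set W) \sum_(x <- fset_set (solutions q))
   (good z * (dominated Phi alpha c w x &&
      `[< congruent alpha q (w (pt x)) (residue_point z) >])))%N.
  apply: eq_bigr => z _.
  under eq_bigr do rewrite -big_distrr /=.
  rewrite -big_distrr /= card_alcove_points //; last first.
    by move=> i; rewrite dot_residue_point natr_int.
  have -> : good z = (z \in [pred z : {ffun 'I_l -> 'I_q} |
      `[< forall a : 'I_l -> int, int_comb alpha a \in Psi ->
            ~~ (q%:Z %| \sum_(i < l) a i * (z i)%:Z)%Z >]]).
    by rewrite inE; apply: asbool_equiv_eq; exact: avoids_residue.
  by case: (z \in _); rewrite ?muln1 ?mul1n.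
rewrite exchange_big /=; apply: eq_big_seq => w; rewrite in_fset_set; last exact: weyl_finite.
rewrite inE => Ww; rewrite exchange_big /=; apply: eq_bigr => x _.
have [z0 cz0] : exists z : {ffun 'I_l -> 'I_q}, congruent alpha q (w (pt x)) (residue_point z).
  apply: congruent_exists => //.
  by have [] := weyl_coweight Ww (sol_point_coweight (alpha := alpha) x).
rewrite (bigD1 z0) //= big1 ?addn0 => [|z zz0]; last first.
  rewrite (_ : `[< _ >] = false) ?andbF ?muln0 //; apply/asboolP => cz.
  by move/eqP: zz0; apply; exact: congruent_unique cz cz0.
rewrite (_ : `[< congruent _ _ _ _ >] = true) ?andbT; last exact/asboolP.
rewrite (_ : good z0 = `[< avoids q (w (pt x)) >]) 1?mulnC ?mulnb //.
by apply: asbool_equiv_eq; apply: iff_sym; exact: avoids_congruent.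
Qed.

(** The indices that [dsc] does not count; their coefficients add up to the exponent [h - dsc]. *)
Definition strict w i := - w (bs i) \notin (pos `\` Psi)%fset.

Definition in_open_part w x := [forall i, strict w i ==> (0 < x i)%N].

Lemma open_part_dominated w x : W w -> in_open_part w x -> dominated Phi alpha c w x.
Proof.
move=> Ww /forallP h; apply/forallP => i; apply/implyP => wi.
have := h i; rewrite /strict in_fsetD (negbTE (pos_opp wi)) andbF.
exact.
Qed.

Lemma dot_ext_simple q x i : (0 < q)%N -> solutions q x ->
  dot (bs i) (pt x) = (x i)%:R - q%:R * (level i)%:~R.
Proof.
move=> q0 xq; have q0' : q%:R != 0 :> R by rewrite pnatr_eq0 -lt0n.
have : lam i (q%:R^-1 *: pt x) = (x i)%:R / q%:R by exact: lam_sol_point.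
rewrite /bary /aff dotZr => e.
have -> : (x i)%:R = q%:R * ((x i)%:R / q%:R) :> R by rewrite mulrC divfK.
by rewrite -e mulrDr mulVKf // addrK.
Qed.

(** If [x i = 0], the root [- w (bs i)] is divisible by [q] at the point, so it is not in [Psi]; it
    is positive by domination, hence in the complement, and [i] is not strict. *)
Lemma avoids_open_part q w x : (0 < q)%N -> W w -> solutions q x ->
  dominated Phi alpha c w x -> avoids q (w (pt x)) -> in_open_part w x.
Proof.
move=> q0 Ww xq /forallP dom av; apply/forallP => i; apply/implyP.
rewrite /strict; apply: contraR; rewrite -eqn0Ngt => /eqP xi0.
have wi : w (bs i) \notin pos by apply/negP => wi; have := dom i; rewrite wi xi0.
have bP : w (bs i) \in Phi by exact: weyl_root Ww (bs_root i).
rewrite in_fsetD pos_oppE // wi andbT; apply/negP => wP.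
apply: (av _ wP); exists (level i).
by rewrite dotNl (weyl_dot _ _ Ww) (dot_ext_simple _ q0 xq) xi0 sub0r opprK.
Qed.

(** Not automatic, since [set_card] is 0 on infinite sets. The pair of the identity and the all-ones
    solution for [q = h] is counted by [card_alcove_points]. *)
Lemma connection_index_gt0 : (0 < connection_index alpha)%N.
Proof.
pose h := coxeter_number c; pose x : {ffun 'I_l.+1 -> nat} := [ffun=> 1%N].
have h0 : (0 < h)%N by rewrite /h /coxeter_number big_ord_recl ext_coef0.
have xh : solutions h x.
  by rewrite /weighted_solutions /=; under eq_bigr do rewrite ffunE muln1.
rewrite -(card_alcove_points h0 (sol_point_coweight (alpha := alpha) x)).
have idW : id \in fset_set W.
  by rewrite in_fset_set ?inE; [exact: weyl_id|exact: weyl_finite].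
have xS : x \in fset_set (solutions h).
  by rewrite in_fset_set ?inE //; apply: solutions_finite; exact: ext_coef_gt0.
rewrite (big_rem (id : 'rV[R]_l -> 'rV[R]_l)) //= (big_rem x) //=.
rewrite (_ : dominated _ _ _ _ _ && _ = true) //.
apply/andP; split; first by apply/forallP => i; rewrite ffunE implybT.
by apply/asboolP; exists 0; [move=> i; rewrite dot0r|rewrite scaler0 addr0].
Qed.

Lemma shift_eulerian q : (0 < q)%N ->
  (connection_index alpha)%:R * shift_op (eulerian Phi alpha c Psi) (ehrhart alpha c) q%:Z
  = (\sum_(w <- fset_set W) \sum_(x <- fset_set (solutions q)) in_open_part w x)%:R.
Proof.
move=> q0; have f0 : (connection_index alpha)%:R != 0 :> rat.
  by rewrite pnatr_eq0 -lt0n connection_index_gt0.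
rewrite /eulerian shift_opZ mulVKf // fsbig_finite; last exact: weyl_finite.
rewrite shift_op_sum natr_sum; apply: eq_bigr => w _; rewrite shift_opXn.
have -> : (coxeter_number c - dsc Phi alpha c Psi w = \sum_(i | strict w i) ext_coef c i)%N.
  rewrite /coxeter_number (bigID (strict w)) /= addnC /dsc.
  by under [X in (_ + _ - X)%N]eq_bigl do rewrite -[_ \in _]negbK -/(strict w _); rewrite addKn.
rewrite ehrhart_positive //; congr (_%:R).
have fS : finite_set (solutions q) by apply: solutions_finite; exact: ext_coef_gt0.
rewrite (@set_card_seq _ _ [seq x <- fset_set (solutions q) | in_open_part w x]).
- by rewrite size_filter -sum1_count big_mkcond; apply: eq_bigr => x _; case: in_open_part.
- by rewrite filter_uniq ?fset_uniq.
- move=> x; rewrite mem_filter in_fset_set //.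
  split=> [[xq xP]|/andP[/forallP xP /set_mem xq]].
    by rewrite mem_set // andbT; apply/forallP => i; apply/implyP/xP.
  by split=> // i; apply/implyP/xP.
Qed.

Lemma formula_iff :
  (forall q : nat, (0 < q)%N -> ((chi_quasi alpha Psi q)%:R : rat) =
     shift_op (eulerian Phi alpha c Psi) (ehrhart alpha c) q%:Z) <->
  (forall q w x, (0 < q)%N -> W w -> solutions q x -> in_open_part w x ->
     avoids q (w (pt x))).
Proof.
have f0 : (connection_index alpha)%:R != 0 :> rat.
  by rewrite pnatr_eq0 -lt0n connection_index_gt0.
have fS q : finite_set (solutions q) by apply: solutions_finite; exact: ext_coef_gt0.
have E q : (0 < q)%N -> ((chi_quasi alpha Psi q)%:R : rat) =
     shift_op (eulerian Phi alpha c Psi) (ehrhart alpha c) q%:Z <->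
   (\sum_(w <- fset_set W) \sum_(x <- fset_set (solutions q))
      (in_open_part w x && ~~ `[< avoids q (w (pt x)) >]))%N = 0%N.
  move=> q0.
  have split_sum : (\sum_(w <- fset_set W) \sum_(x <- fset_set (solutions q))
      in_open_part w x = connection_index alpha * chi_quasi alpha Psi q +
      \sum_(w <- fset_set W) \sum_(x <- fset_set (solutions q))
      (in_open_part w x && ~~ `[< avoids q (w (pt x)) >]))%N.
    rewrite chi_count // -big_split; apply: eq_big_seq => w.
    rewrite in_fset_set; last exact: weyl_finite.
    move=> /set_mem Ww; rewrite -big_split; apply: eq_big_seq => x.
    rewrite in_fset_set // => /set_mem xq /=.
    have := @avoids_open_part q w x q0 Ww xq; have := @open_part_dominated w x Ww.
    case: in_open_part; case: dominated; case: asboolP => //= av h1 h2;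
      by first [have := h1 isT | have := h2 isT av].
  split=> [e|e]; last first.
    apply: (mulfI f0); rewrite shift_eulerian // split_sum e addn0.
    by rewrite natrM.
  have /eqP := shift_eulerian q0; rewrite -e -natrM eqr_nat split_sum.
  by rewrite -{1}[X in X == _]addn0 eqn_add2l => /eqP.
split=> h.
  move=> q w x q0 Ww xq wx; have /E/eqP := h q q0.
  rewrite sum_nat_seq_eq0 => /(_ q0)/allP/(_ w).
  rewrite in_fset_set ?mem_set //; last exact: weyl_finite.
  move=> /(_ isT); rewrite sum_nat_seq_eq0 => /allP/(_ x).
  rewrite in_fset_set ?mem_set // wx => /(_ isT) /=.
  by rewrite eqb0 negbK => /asboolP.
move=> q q0; apply/E => //; apply: big1_seq => w /andP[_].
rewrite in_fset_set; last exact: weyl_finite.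
move=> /set_mem Ww; apply: big1_seq => x /andP[_]; rewrite in_fset_set // => /set_mem xq.
case: (boolP (in_open_part w x)) => //= wx.
by rewrite (_ : `[< _ >] = true) //; apply/asboolP; exact: h.
Qed.

End Formula.

(** * Alcoves, their walls and their presentations *)

Section Compatibility.
Context (R : realType) (l : nat) (Phi : {fset 'rV[R]_l})
  (alpha : 'I_l -> 'rV[R]_l) (c : 'I_l -> nat) {RD : root_data Phi alpha c}.
Implicit Types (b p u x : 'rV[R]_l) (w : 'rV[R]_l -> 'rV[R]_l) (g : 'rV[R]_l).

Local Notation bs := (ext_simple alpha c).
Local Notation lam := (bary alpha c).
Local Notation W := (weyl_group Phi).
Local Notation Z := (coweight_lattice alpha).
Local Notation pos := (positive_roots Phi alpha).

(* The barycentric coordinates of the alcove [w A + g]. *)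
Definition wall w g i x : R := dot (w (bs i)) (x - g) + (level i)%:~R.

Definition alcove w g : set 'rV[R]_l := [set x | forall i, 0 < wall w g i x].

Lemma wallE w g i u : W w -> wall w g i (w u + g) = lam i u.
Proof. by move=> Ww; rewrite /wall addrK weyl_dot. Qed.

Lemma weyl_affine_inv w g x : W w -> exists u, x = w u + g.
Proof.
move=> Ww; have [v [Wv wv vw]] := weyl_inv Ww.
by exists (v (x - g)); rewrite vw subrK.
Qed.

Lemma wall_aff w g i : W w -> Z g ->
  exists k : int, forall x, wall w g i x = aff (w (bs i)) k x.
Proof.
move=> Ww Zg; have [k e] := coweight_int (weyl_root Ww (bs_root i)) Zg.
by exists (level i - k) => x; rewrite /wall /aff dotBr e intrB; ring.
Qed.

Lemma wall_segment w g i (t : R) x y :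
  wall w g i (x + t *: (y - x)) = (1 - t) * wall w g i x + t * wall w g i y.
Proof. by rewrite /wall !(dotBr, dotDr, dotZr); ring. Qed.

Lemma aff_pullback w g b m : W w -> Z g -> b \in Phi -> exists b' k,
  b' \in Phi /\ forall u, aff b m (w u + g) = aff b' k u.
Proof.
move=> Ww Zg bP; have [k e] := coweight_int bP Zg.
have [v [Wv wv vw]] := weyl_inv Ww.
exists (v b), (m + k); split=> [|u]; first exact: weyl_root.
by rewrite /aff dotDr e -{1}(vw b) weyl_dot // intrD; ring.
Qed.

Lemma alcove_regular w g x : W w -> Z g -> alcove w g x -> regular Phi x.
Proof.
move=> Ww Zg; have [u ->] := weyl_affine_inv g x Ww => xA b m bP.
have [b' [k [b'P ->]]] := aff_pullback m Ww Zg bP.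
by apply: aff_neq0 => // i; have := xA i; rewrite wallE.
Qed.

Lemma affine_complementP x : affine_complement Phi alpha x <-> regular Phi x.
Proof.
split=> [h b m bP|h [b bp [m _]]]; last first.
  by rewrite /hyperplane /= => e; have := h b (- m) (pos_root bp);
    rewrite /aff e intrN subrr eqxx.
have reg d k : d \in pos -> aff d k x != 0.
  move=> dp; apply/eqP => e; apply: h; exists d => //; exists (- k) => //.
  by rewrite /hyperplane /= intrN; apply/eqP; rewrite -subr_eq0 opprK; apply/eqP.
have [bp|bp] := orP (root_pos bP); first exact: reg.
by rewrite -oppr_eq0 -aff_opp reg.
Qed.

Lemma segment_connected_set x y :
  connected [set x + t *: (y - x) | t in `[0 : R, 1]].
Proof.
apply: connected_continuous_connected; first exact: segment_connected.
apply: continuous_subspaceT => t; apply: cvgD; first exact: cvg_cst.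
exact: cvgZr_tmp.
Qed.

(** The alcove is convex, hence connected. Conversely a wall coordinate changing sign on the
    component would vanish somewhere on it, but the component avoids all hyperplanes. *)
Lemma component_alcove w g x : W w -> Z g -> alcove w g x ->
  connected_component (affine_complement Phi alpha) x = alcove w g.
Proof.
move=> Ww Zg xA.
have compl y : alcove w g y -> affine_complement Phi alpha y.
  by move=> yA; apply/affine_complementP; exact: alcove_regular yA.
apply/seteqP; split=> y; last first.
  move=> yA; apply: (@connected_component_max _ _ [set x + t *: (y - x) | t in `[0 : R, 1]]).
  - by exists 0; rewrite /= ?in_itv /= ?lexx ?ler01 // scale0r addr0.
  - move=> _ [t t01 <-]; apply: compl => i; rewrite wall_segment.
    move: t01; rewrite /= in_itv /= => /andP[t0 t1].
    have [->|tn] := eqVneq t 0; first by rewrite subr0 mul1r mul0r addr0.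
    rewrite ltr_wpDl ?mulr_ge0 ?mulr_gt0 ?subr_ge0 ?(ltW (xA i)) //.
    by rewrite lt0r tn.
  - exact: segment_connected_set.
  - by exists 1; rewrite /= ?in_itv /= ?lexx ?ler01 // scale1r subrKC.
move=> yC i; rewrite ltNge; apply/negP => yi.
have [k hk] := wall_aff i Ww Zg.
pose C := connected_component (affine_complement Phi alpha) x.
have : connected (wall w g i @` C).
  apply: connected_continuous_connected; first exact: component_connected.
  apply: continuous_subspaceT; rewrite (_ : wall w g i = aff (w (bs i)) k).
    exact: aff_continuous.
  exact/funext.
move=> /connected_intervalP itv.
have [z Cz z0] : (wall w g i @` C) 0.
  apply: (itv (wall w g i y) (wall w g i x)).
  - by exists y.
  - by exists x => //; apply: connected_component_refl; exact: compl.
  - by rewrite yi ltW.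
have /affine_complementP zr := connected_component_sub Cz.
have wP : w (bs i) \in Phi by exact: weyl_root Ww (bs_root i).
by have := zr _ k wP; rewrite -hk z0 eqxx.
Qed.

Lemma is_alcoveP A : is_alcove Phi alpha A <->
  exists w g, [/\ W w, Z g & A = alcove w g].
Proof.
split=> [[x /affine_complementP rx ->]|[w [g [Ww Zg ->]]]].
  have [w [g [u [Ww Qg uA e]]]] := alcove_cover rx.
  have Zg : Z g by exact: coroot_coweight.
  exists w, g; split=> //; apply: component_alcove => // i.
  by rewrite e wallE.
have [u uA] := @alcove_point _ _ _ _ _ RD.
have xA : alcove w g (w u + g) by move=> i; rewrite wallE.
exists (w u + g); last by rewrite (component_alcove Ww Zg xA).
by apply/affine_complementP; exact: alcove_regular xA.
Qed.

Lemma lam_point (t : 'I_l.+1 -> R) : \sum_i (ext_coef c i)%:R * t i = 1 ->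
  exists u, forall i, lam i u = t i.
Proof.
move=> t1; pose u : 'rV[R]_l := \sum_j t (lift ord0 j) *: coweight alpha j.
have lu j : lam (lift ord0 j) u = t (lift ord0 j).
  rewrite lam_liftE dot_sumr (bigD1 j) //= dotZr dot_coweight eqxx mulr1.
  by rewrite big1 ?addr0 // => k kj; rewrite dotZr dot_coweight eq_sym (negbTE kj) mulr0.
exists u => i; case: (unliftP ord0 i) => [j|] ->; first exact: lu.
have : \sum_j (ext_coef c j)%:R * lam j u = 1 by exact: sum_lam.
rewrite -[RHS]t1 !big_ord_recl ext_coef0 !mul1r.
under eq_bigr do rewrite lu.
exact: addIr.
Qed.

(** If two walls had the same root, [lam i - lam j] would be constant, yet it has opposite signs at
    the vertices [i] and [j]. *)
Lemma bs_inj : injective bs.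
Proof.
move=> i j e; apply/eqP/negPn/negP => ij.
have E x : lam i x - lam j x = (level i)%:~R - (level j)%:~R.
  by rewrite /bary /aff e; ring.
have := E (vertex alpha c i); rewrite -(E (vertex alpha c j)) !lam_vertex !eqxx.
rewrite (negbTE ij) eq_sym (negbTE ij) !mul0r !mul1r subr0 sub0r => e'.
have : 0 < (ext_coef c i)%:R^-1 :> R by rewrite invr_gt0 ltr0n ext_coef_gt0.
by rewrite e' oppr_gt0 invr_lt0 ltrn0.
Qed.

Lemma facet_center i : exists2 u, lam i u = 0 & forall j, j != i -> 0 < lam j u.
Proof.
pose s : nat := (\sum_(j | j != i) ext_coef c j)%N.
have s0 : (0 < s)%N.
  have [j ji] : exists j : 'I_l.+1, j != i by exact: other_index.
  by rewrite /s (bigD1 j) //= ltn_addr // ext_coef_gt0.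
have s0' : s%:R != 0 :> R by rewrite pnatr_eq0 -lt0n.
have [|u hu] := @lam_point (fun j => (j != i)%:R / s%:R).
  rewrite (bigD1 i) //= eqxx mul0r mulr0 add0r.
  rewrite (eq_bigr (fun j => (ext_coef c j)%:R / s%:R)); last by move=> j ->; rewrite mul1r.
  by rewrite -mulr_suml -natr_sum mulfV.
exists u => [|j ji]; rewrite hu ?eqxx ?mul0r //.
by rewrite ji mul1r invr_gt0 ltr0n.
Qed.

(** At a relative interior point of facet [i] all other coordinates are positive, so a vanishing
    natural combination keeps only its [i]-th coefficient. *)
Lemma facet_hyperplane b m i u : b \in Phi -> lam i u = 0 ->
  (forall j, j != i -> 0 < lam j u) -> aff b m u = 0 ->
  (forall x, aff b m x = lam i x) \/ (forall x, aff b m x = - lam i x).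
Proof.
move=> bP ui uj bu.
have single d k (n : 'I_l.+1 -> nat) : d \in Phi -> aff d k u = 0 ->
    (forall x, aff d k x = \sum_j (n j)%:R * lam j x) -> forall x, aff d k x = lam i x.
  move=> dP du h; apply: (comb_single dP h) => j ji.
  move/eqP: du; rewrite h psumr_eq0 => [/allP/(_ j (mem_index_enum _))|j' _].
    by rewrite mulf_eq0 (gt_eqF (uj j ji)) orbF pnatr_eq0 => /eqP.
  rewrite mulr_ge0 //; have [->|/uj/ltW//] := eqVneq j' i; by rewrite ui.
have [n [h|h]] := root_comb m bP; first by left; exact: single h.
right=> x; rewrite -[LHS]opprK -aff_opp; congr (- _).
apply: single (root_opp bP) _ _ x => [|y]; first by rewrite aff_opp bu oppr0.
by rewrite aff_opp; exact: h.
Qed.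

Lemma wall_facet_center w g i : W w ->
  exists2 e, wall w g i e = 0 & forall j, j != i -> 0 < wall w g j e.
Proof.
move=> Ww; have [u ui uj] := facet_center i.
by exists (w u + g) => [|j ji]; rewrite wallE //; exact: uj.
Qed.

Lemma wall_hyperplane w g b m i e : W w -> Z g -> b \in Phi -> wall w g i e = 0 ->
  (forall j, j != i -> 0 < wall w g j e) -> aff b m e = 0 ->
  (b = w (bs i) /\ forall x, aff b m x = wall w g i x) \/
  (b = - w (bs i) /\ forall x, aff b m x = - wall w g i x).
Proof.
move=> Ww Zg bP ei ej be; have [u eE] := weyl_affine_inv g e Ww.
have [b' [k [b'P hb]]] := aff_pullback m Ww Zg bP.
have [kw hw] := wall_aff i Ww Zg.
have [|j ji||h|h] := @facet_hyperplane b' k i u b'P.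
- by rewrite -(wallE g i u Ww) -eE.
- by rewrite -(wallE g j u Ww) -eE; exact: ej.
- by rewrite -hb -eE.
- have E x : aff b m x = wall w g i x.
    by have [y ->] := weyl_affine_inv g x Ww; rewrite hb h wallE.
  left; split=> //; rewrite -[RHS]scale1r; apply: (proj1 (@aff_inj _ _ _ _ _ RD b m _ kw _ _)).
  by move=> x; rewrite mul1r -hw.
- have E x : aff b m x = - wall w g i x.
    by have [y ->] := weyl_affine_inv g x Ww; rewrite hb h wallE.
  right; split=> //; rewrite -[RHS]scaleN1r; apply: (proj1 (@aff_inj _ _ _ _ _ RD b m _ kw _ _)).
  by move=> x; rewrite mulN1r -hw.
Qed.

End Compatibility.

(** * Presentations of an alcove and its walls *)

Section Presentations.
Context (R : realType) (l : nat) (Phi : {fset 'rV[R]_l})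
  (alpha : 'I_l -> 'rV[R]_l) (c : 'I_l -> nat) {RD : root_data Phi alpha c}.
Implicit Types (b p u x : 'rV[R]_l) (w : 'rV[R]_l -> 'rV[R]_l) (g : 'rV[R]_l).

Local Notation bs := (ext_simple alpha c).
Local Notation in_alcove := (in_alcove alpha c).
Local Notation W := (weyl_group Phi).
Local Notation Z := (coweight_lattice alpha).
Local Notation pos := (positive_roots Phi alpha).
Local Notation wall := (wall alpha c).
Local Notation alcove := (alcove alpha c).

(** Each wall is written with a positive root: [w (bs i)] bounds the alcove from below if positive,
    and otherwise its opposite bounds it from above. *)
Definition lower_walls w : {fset 'rV[R]_l} :=
  [fset w (bs i) | i in [pred i | w (bs i) \in pos]]%fset.

Definition upper_walls w : {fset 'rV[R]_l} :=
  [fset - w (bs i) | i in [pred i | w (bs i) \notin pos]]%fset.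

Lemma lower_wallsP w a :
  reflect (exists2 i, w (bs i) \in pos & a = w (bs i)) (a \in lower_walls w).
Proof.
by apply: (iffP (imfsetP _ _ _ _)) => -[i wi ->]; exists i.
Qed.

Lemma upper_wallsP w a :
  reflect (exists2 i, w (bs i) \notin pos & a = - w (bs i)) (a \in upper_walls w).
Proof.
by apply: (iffP (imfsetP _ _ _ _)) => -[i wi ->]; exists i.
Qed.

Lemma weyl_inj w : W w -> injective w.
Proof. by move=> Ww; have [v [_ wv _]] := weyl_inv Ww; exact: can_inj wv. Qed.

Lemma card_walls w : W w -> (#|` lower_walls w| + #|` upper_walls w| = l.+1)%N.
Proof.
move=> Ww; rewrite !card_imfset /=; last first.
- by move=> i j /(weyl_inj Ww)/bs_inj.
- by move=> i j /oppr_inj/(weyl_inj Ww)/bs_inj.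
rewrite -!cardE -[RHS]card_ord -(cardC [pred i | w (bs i) \in pos]); congr addn.
Qed.

Section Uniqueness.
Variables (w : 'rV[R]_l -> 'rV[R]_l) (g : 'rV[R]_l) (I J : {fset 'rV[R]_l}).
Variables (kI kJ : 'rV[R]_l -> int).
Hypotheses (Ww : W w) (Zg : Z g).
Hypothesis pres : presentation Phi alpha (alcove w g) I J kI kJ.

Let alcoveE x : alcove w g x <-> (forall a, a \in I -> (kI a)%:~R < dot a x) /\
  (forall b, b \in J -> dot b x < (kJ b)%:~R).
Proof. by rewrite {1}(pres_alcove pres). Qed.

Let inner : exists x, alcove w g x.
Proof.
have [u uA] := @alcove_point _ _ _ _ _ RD.
by exists (w u + g) => i; rewrite wallE.
Qed.

(** Replaces the limit [t -> 0] when strict inequalities along a segment are passed to its boundary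
    end. *)
Lemma small_multiple (d e : R) : (forall t, 0 < t <= 1 -> d < t * e) -> d <= 0.
Proof.
move=> h; rewrite leNgt; apply/negP => d0.
have de : d < e by have := h 1; rewrite mul1r ltr01 lexx; exact.
have e0 : 0 < e by exact: lt_trans de.
have := h (d / (2 * e)); rewrite divr_gt0 ?mulr_gt0 //= ler_pdivrMr ?mulr_gt0 //.
have -> : d / (2 * e) * e = d / 2 by field; rewrite lt0r_neq0.
move=> h'; have : d < d / 2 by apply: h'; lra.
by lra.
Qed.

(** The facet center [e] is outside the alcove but a limit of its points, so some inequality of the
    presentation is tight at [e]. Only wall [i] passes through [e], and the inner point [x0] decides
    the sign. *)
Lemma wall_presented i :
  (w (bs i) \in I /\ forall x, wall w g i x = dot (w (bs i)) x - (kI (w (bs i)))%:~R) \/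
  (- w (bs i) \in J /\ forall x, wall w g i x = (kJ (- w (bs i)))%:~R - dot (- w (bs i)) x).
Proof.
have [e ei ej] := wall_facet_center g i Ww.
have [x0 x0A] := inner.
have nA : ~ alcove w g e by move=> /(_ i); rewrite ei ltxx.
have toA t : 0 < t <= 1 -> alcove w g (e + t *: (x0 - e)).
  move=> /andP[t0 t1] j; rewrite wall_segment ltr_wpDl ?mulr_gt0 //.
  rewrite mulr_ge0 ?subr_ge0 //; have [->|/ej/ltW//] := eqVneq j i.
  by rewrite ei.
have [a0 b0] := (alcoveE x0).1 x0A.
have wI a : a \in I -> (kI a)%:~R <= dot a e.
  move=> aI; rewrite -subr_le0; apply: (@small_multiple _ (dot a x0 - dot a e)).
  move=> t /toA/alcoveE[/(_ a aI) + _].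
  by rewrite dotDr dotZr dotBr ltrBlDl.
have wJ b : b \in J -> dot b e <= (kJ b)%:~R.
  move=> bJ; rewrite -subr_le0; apply: (@small_multiple _ (dot b e - dot b x0)).
  move=> t /toA/alcoveE[_ /(_ b bJ)].
  by rewrite dotDr dotZr dotBr; lra.
have [[a aI ae]|[b bJ be]] : (exists2 a, a \in I & dot a e = (kI a)%:~R) \/
    (exists2 b, b \in J & dot b e = (kJ b)%:~R).
  apply: contra_notP nA => /not_orP[/forall2NP nI /forall2NP nJ]; apply/alcoveE.
  split=> [a aI|b bJ]; rewrite lt_neqAle ?wI ?wJ // andbT; apply/eqP => h.
    by have [|] := nI a; [|rewrite h].
  by have [|] := nJ b; [|rewrite h].
- have aP : a \in Phi by exact: pos_root (fsubsetP (pres_lower pres) _ aI).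
  have a0' := a0 a aI; have x0i := x0A i.
  have [|[aE h]|[aE h]] := @wall_hyperplane _ _ _ _ _ RD w g a (- kI a) i e Ww Zg aP ei ej.
  + by rewrite /aff ae intrN subrr.
  + by left; rewrite -aE; split=> // x; rewrite -h /aff intrN.
  + by have := h x0; rewrite /aff intrN; lra.
- have bP : b \in Phi by exact: pos_root (fsubsetP (pres_upper pres) _ bJ).
  have b0' := b0 b bJ; have x0i := x0A i.
  have [|[bE h]|[bE h]] := @wall_hyperplane _ _ _ _ _ RD w g b (- kJ b) i e Ww Zg bP ei ej.
  + by rewrite /aff be intrN subrr.
  + by have := h x0; rewrite /aff intrN; lra.
  + by right; rewrite -bE; split=> // x; have := h x; rewrite /aff intrN; lra.
Qed.

Lemma lower_wall_presented i : w (bs i) \in pos ->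
  w (bs i) \in I /\ forall x, wall w g i x = dot (w (bs i)) x - (kI (w (bs i)))%:~R.
Proof.
move=> wi; have [//|[/(fsubsetP (pres_upper pres)) + _]] := wall_presented i.
by rewrite (negbTE (pos_opp wi)).
Qed.

Lemma upper_wall_presented i : w (bs i) \notin pos ->
  - w (bs i) \in J /\ forall x, wall w g i x = (kJ (- w (bs i)))%:~R - dot (- w (bs i)) x.
Proof.
move=> wi; have [[/(fsubsetP (pres_lower pres)) + _]|//] := wall_presented i.
by rewrite (negbTE wi).
Qed.

(** All [l + 1] walls occur in the presentation, and its cardinality leaves room for nothing
    else. *)
Lemma presentation_walls : I = lower_walls w /\ J = upper_walls w.
Proof.
have sI : (lower_walls w `<=` I)%fset.
  by apply/fsubsetP => _ /lower_wallsP[i wi ->]; have [] := lower_wall_presented wi.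
have sJ : (upper_walls w `<=` J)%fset.
  by apply/fsubsetP => _ /upper_wallsP[i wi ->]; have [] := upper_wall_presented wi.
have cIJ : (#|` lower_walls w| + #|` upper_walls w| = #|` I| + #|` J|)%N.
  by rewrite card_walls // (pres_card pres).
have cI := fsubset_leq_card sI; have cJ := fsubset_leq_card sJ.
split; apply/esym/eqP; rewrite eqEfcard ?sI ?sJ /=.
  by rewrite -(leq_add2r #|` upper_walls w|) cIJ leq_add2l.
by rewrite -(leq_add2l #|` lower_walls w|) cIJ leq_add2r.
Qed.

Lemma partial_closureP x : partial_closure I J kI kJ x <->
  forall i, 0 <= wall w g i x /\ (w (bs i) \in pos -> 0 < wall w g i x).
Proof.
have [IE JE] := presentation_walls; split=> [[hI hJ] i|h].
  have [wi|wi] := boolP (w (bs i) \in pos).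
    have [aI ->] := lower_wall_presented wi.
    by rewrite subr_ge0 subr_gt0 hI // ltW ?hI.
  have [bJ ->] := upper_wall_presented wi.
  by rewrite subr_ge0 hJ //; split.
split=> [a|b].
  rewrite {1}IE => /lower_wallsP[i wi ->]; have [_ e] := lower_wall_presented wi.
  by have [_ /(_ wi)] := h i; rewrite e subr_gt0.
rewrite {1}JE => /upper_wallsP[i wi ->]; have [_ e] := upper_wall_presented wi.
by have [+ _] := h i; rewrite e subr_ge0.
Qed.

End Uniqueness.

(** No hyperplane meets the alcove, so integer parts at one inner point give the levels; the box
    makes positive roots positive there, whence the sign conditions. *)
Lemma presentation_exists w g : W w -> Z g ->
  alcove w g `<=` worpitzky_box alpha ->
  exists kI kJ, presentation Phi alpha (alcove w g) (lower_walls w) (upper_walls w) kI kJ.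
Proof.
move=> Ww Zg box; have [u uA] := @alcove_point _ _ _ _ _ RD.
pose x0 := w u + g.
have x0A : alcove w g x0 by move=> i; rewrite wallE.
have x0pos b : b \in pos -> 0 < dot b x0.
  move=> /posP[bP [n e]]; rewrite lt0r; apply/andP; split.
    have := alcove_regular Ww Zg x0A 0 bP; rewrite /aff addr0; exact.
  rewrite e dot_nat_comb; apply: sumr_ge0 => i _; rewrite mulr_ge0 //.
  by have /andP[/ltW] := box _ x0A i.
pose kI a := Num.floor (dot a x0); pose kJ a := Num.floor (dot a x0) + 1.
have x01 i : wall w g i x0 < 1 by rewrite wallE //; exact: in_alcove_lt1.
have lowE i x : wall w g i x = dot (w (bs i)) x - (kI (w (bs i)))%:~R.
  have [k hk] := wall_aff i Ww Zg; rewrite hk /aff; congr (_ + _).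
  rewrite -intrN; congr (_%:~R); apply/eqP; rewrite -eqr_oppLR eq_sym floor_eq.
  by have := x0A i; have := x01 i; rewrite hk /aff intrD intrN; lra.
have upE i x : wall w g i x = (kJ (- w (bs i)))%:~R - dot (- w (bs i)) x.
  have [k hk] := wall_aff i Ww Zg; rewrite hk /aff dotNl opprK addrC; congr (_ + _).
  rewrite /kJ; congr (_%:~R); apply/eqP; rewrite -subr_eq eq_sym floor_eq subrK.
  by have := x0A i; have := x01 i; rewrite hk /aff dotNl intrB; lra.
exists kI, kJ; split.
- by apply/fsubsetP => _ /lower_wallsP[i wi ->].
- apply/fsubsetP => _ /upper_wallsP[i wi ->].
  by rewrite pos_oppE //; exact: weyl_root Ww (bs_root i).
- exact: card_walls.
- by move=> _ /lower_wallsP[i wi ->]; rewrite /kI floor_ge0 ltW ?x0pos.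
- move=> _ /upper_wallsP[i wi ->]; rewrite /kJ ltzD1 floor_ge0 ltW ?x0pos //.
  by rewrite pos_oppE //; exact: weyl_root Ww (bs_root i).
- apply/seteqP; split=> x.
    move=> xA; split=> [_ /lower_wallsP[i wi ->]|_ /upper_wallsP[i wi ->]].
      by have := xA i; rewrite lowE subr_gt0.
    by have := xA i; rewrite upE subr_gt0.
  move=> [hI hJ] i; have [wi|wi] := boolP (w (bs i) \in pos).
    by rewrite lowE subr_gt0; apply: hI; apply/lower_wallsP; exists i.
  by rewrite upE subr_gt0; apply: hJ; apply/upper_wallsP; exists i.
Qed.

(** Subtract the integer parts of the simple-root values at one inner point; no hyperplane cuts the
    alcove, so the bounds hold at all its points. *)
Lemma translate_into_box w : W w -> exists2 g, Z g & alcove w g `<=` worpitzky_box alpha.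
Proof.
move=> Ww; have [u uA] := @alcove_point _ _ _ _ _ RD.
pose f i : int := Num.floor (dot (alpha i) (w u)).
have dotf i : dot (alpha i) (\sum_j (f j)%:~R *: coweight alpha j) = (f i)%:~R.
  rewrite dot_sumr (bigD1 i) //= dotZr dot_coweight eqxx mulr1 big1 ?addr0 // => j ji.
  by rewrite dotZr dot_coweight eq_sym (negbTE ji) mulr0.
exists (- \sum_j (f j)%:~R *: coweight alpha j) => [i|x xA i].
  by rewrite dotNr dotf rpredN intr_int.
have [u' xE] := weyl_affine_inv (- \sum_j (f j)%:~R *: coweight alpha j) x Ww.
have u'A : in_alcove u'.
  move=> j; have := xA j; rewrite {1}xE.
  by rewrite (@wallE _ _ _ alpha c _ w _ j u' Ww).
have [v [Wv wv vw]] := weyl_inv Ww.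
have vP : v (alpha i) \in Phi by exact: weyl_root Wv (simple_root i).
have dotv y : dot (alpha i) (w y) = dot (v (alpha i)) y.
  by rewrite -{1}(vw (alpha i)) weyl_dot.
have sign m : 0 <= aff (v (alpha i)) m u -> 0 <= aff (v (alpha i)) m u'.
  by move=> /(aff_comb vP uA)[n ->]; exact: comb_ge0.
have signN m : aff (v (alpha i)) m u <= 0 -> aff (v (alpha i)) m u' <= 0.
  rewrite -oppr_ge0 -aff_opp => /(aff_comb (root_opp vP) uA)[n h].
  by rewrite -oppr_ge0 -aff_opp h; exact: comb_ge0.
have /andP[f0 f1] : (f i)%:~R <= dot (v (alpha i)) u < (f i + 1)%:~R.
  by rewrite -floor_eq -dotv.
have low : 0 < aff (v (alpha i)) (- f i) u'.
  rewrite lt0r aff_neq0 //=; apply: sign.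
  by rewrite /aff intrN subr_ge0.
have up : aff (v (alpha i)) (- (f i + 1)) u' <= 0.
  by apply: signN; rewrite /aff intrN subr_le0 ltW.
rewrite xE dotDr dotNr dotf dotv; move: low up; rewrite /aff !intrN intrD; lra.
Qed.

End Presentations.

(** * Compatibility *)

Section Equivalence.
Context (R : realType) (l : nat) (Phi : {fset 'rV[R]_l})
  (alpha : 'I_l -> 'rV[R]_l) (c : 'I_l -> nat) {RD : root_data Phi alpha c}.
Variable Psi : {fset 'rV[R]_l}.
Hypothesis Psi_pos : (Psi `<=` positive_roots Phi alpha)%fset.
Implicit Types (b p u x : 'rV[R]_l) (w : 'rV[R]_l -> 'rV[R]_l) (g : 'rV[R]_l).

Local Notation bs := (ext_simple alpha c).
Local Notation lam := (bary alpha c).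
Local Notation W := (weyl_group Phi).
Local Notation Z := (coweight_lattice alpha).
Local Notation solutions := (weighted_solutions (ext_coef c)).
Local Notation pos := (positive_roots Phi alpha).
Local Notation pt := (sol_point alpha).
Local Notation wall := (wall alpha c).
Local Notation alcove := (alcove alpha c).

(** If a root of [Psi] were divisible by [q], compatibility would put the point [p] on a facet
    carried by [Psi]. Lower walls are excluded from the partial closure; an upper wall forces
    [x i = 0] at an index [i] that is strict. *)
Lemma compatible_avoids : compatible Phi alpha Psi ->
  forall q w (x : {ffun 'I_l.+1 -> nat}), (0 < q)%N -> W w -> solutions q x ->
    in_open_part Phi alpha c Psi w x -> avoids Psi q (w (pt x)).
Proof.
move=> comp q w x q0 Ww xq op b bPsi [k e].
have q0' : q%:R != 0 :> R by rewrite pnatr_eq0 -lt0n.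
have [g Zg box] := translate_into_box Ww.
have [kI [kJ pres]] := presentation_exists Ww Zg box.
have DP y : partial_closure (lower_walls Phi alpha c w) (upper_walls Phi alpha c w) kI kJ y <->
    forall i, 0 <= wall w g i y /\ (w (bs i) \in pos -> 0 < wall w g i y).
  exact: partial_closureP.
pose p := w (q%:R^-1 *: pt x) + g.
have wp i : wall w g i p = (x i)%:R / q%:R.
  by rewrite wallE // (lam_sol_point i q0 xq).
have /forallP dom : dominated Phi alpha c w x by exact: open_part_dominated op.
have Dp : partial_closure (lower_walls Phi alpha c w) (upper_walls Phi alpha c w) kI kJ p.
  apply/DP => i; rewrite wp divr_ge0 //; split=> // wi.
  by rewrite divr_gt0 ?ltr0n //; have := dom i; rewrite wi.
have [n gn] := coweight_int (pos_root (fsubsetP Psi_pos _ bPsi)) Zg.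
have pb : hyperplane b (k + n) p.
  by rewrite /hyperplane /= dotDr (weylZ _ _ Ww) dotZr e mulKf // gn intrD.
have Aalc : is_alcove Phi alpha (alcove w g).
  by apply/(@is_alcoveP _ _ _ _ c); exists w, g.
have [e0|[b' [m' [b'Psi sub [_ [[a aI aE]|[b2 b2J b2E]]]]]]] :=
  comp _ Aalc box _ _ _ _ pres b (k + n) bPsi.
- by have : (set0 : set 'rV[R]_l) p by rewrite -e0.
- have [[aD _] ap] : (partial_closure (lower_walls Phi alpha c w)
    (upper_walls Phi alpha c w) kI kJ `&` hyperplane a (kI a)) p by rewrite -aE; exact: sub.
  by have := aD a aI; rewrite ap ltxx.
have /upper_wallsP[i wi b2i] := b2J.
have [_ wE] := upper_wall_presented Ww Zg pres wi.
have [ec ei ej] := wall_facet_center g i Ww.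
have Dec : partial_closure (lower_walls Phi alpha c w) (upper_walls Phi alpha c w) kI kJ ec.
  apply/DP => j; have [->|ji] := eqVneq j i; first by rewrite ei (negbTE wi).
  by split=> [|_]; [apply/ltW|]; exact: ej.
have b2ec : hyperplane b2 (kJ b2) ec.
  by apply/eqP; rewrite b2i eq_sym -subr_eq0 -wE ei.
have [_ b'ec] : (partial_closure (lower_walls Phi alpha c w)
    (upper_walls Phi alpha c w) kI kJ `&` hyperplane b' m') ec by rewrite b2E.
have b'pos := fsubsetP Psi_pos _ b'Psi.
(* The facet is known only as a set; its center lies on both hyperplanes and only one positive root
   has a hyperplane through it. *)
have b'b2 : b' = b2.
  have [|[e' _]|[e' _]] := @wall_hyperplane _ _ _ _ _ RD w g b' (- m') i ec Ww Zg
    (pos_root b'pos) ei ej.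
  - by rewrite /aff b'ec intrN subrr.
  - by move: b'pos; rewrite e' (negbTE wi).
  - by rewrite e' b2i.
have [_ b2p] : (partial_closure (lower_walls Phi alpha c w)
    (upper_walls Phi alpha c w) kI kJ `&` hyperplane b2 (kJ b2)) p by rewrite -b2E; exact: sub.
have xi0 : x i = 0%N.
  have : wall w g i p = 0 by rewrite wE -b2i b2p subrr.
  by rewrite wp => /eqP; rewrite mulf_eq0 invr_eq0 (negbTE q0') orbF pnatr_eq0 => /eqP.
have := forallP op i; rewrite xi0 implybF /strict in_fsetD negbK -b2i -b'b2.
by rewrite b'Psi.
Qed.

(** A midpoint keeps every coordinate that is positive at one end and nonnegative at the other. *)
Lemma common_positive (C : set 'rV[R]_l) w g (s : seq 'I_l.+1) :
  C !=set0 -> (forall x y, C x -> C y -> C (x + 2^-1 *: (y - x))) ->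
  (forall i x, C x -> 0 <= wall w g i x) ->
  (forall i, i \in s -> exists2 x, C x & 0 < wall w g i x) ->
  exists2 x, C x & forall i, i \in s -> 0 < wall w g i x.
Proof.
move=> [x0 Cx0] mid C0; elim: s => [|i s IH] h; first by exists x0.
have [|x Cx xs] := IH; first by move=> j js; apply: h; rewrite inE js orbT.
have [y Cy yi] := h i (mem_head _ _).
exists (x + 2^-1 *: (y - x)); first exact: mid.
move=> j; rewrite inE wall_segment => /predU1P[->|/xs xj].
  by have := C0 i x Cx; move: yi; lra.
by have := C0 j y Cy; move: xj; lra.
Qed.

(* Whether an integral hyperplane contains a point of the closed fundamental
   alcove depends only on which barycentric coordinates of the point vanish, so
   that the point may be replaced by one with coordinates [0] or [1 / q]. *)
Lemma support_divisible b (k : int) u (x : {ffun 'I_l.+1 -> nat}) q :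
  (0 < q)%N -> solutions q x -> b \in Phi -> (forall i, 0 <= lam i u) ->
  (forall i, x i = (0 < lam i u) :> nat) -> dot b u = k%:~R ->
  dot b (pt x) = q%:R * k%:~R.
Proof.
move=> q0 xq bP u0 xE bu; have q0' : q%:R != 0 :> R by rewrite pnatr_eq0 -lt0n.
have zero (n : 'I_l.+1 -> nat) : \sum_i (n i)%:R * lam i u = 0 ->
    \sum_i (n i)%:R * lam i (q%:R^-1 *: pt x) = 0.
  move=> /eqP; rewrite psumr_eq0 => [/allP n0|i _]; last by rewrite mulr_ge0.
  apply: big1 => i _; rewrite (lam_sol_point i q0 xq) xE.
  have := n0 i (mem_index_enum _); rewrite mulf_eq0 => /orP[/eqP ->|/eqP ->].
    by rewrite mul0r.
  by rewrite ltxx mul0r mulr0.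
have bu0 : aff b (- k) u = 0 by rewrite /aff bu intrN subrr.
suff : aff b (- k) (q%:R^-1 *: pt x) = 0.
  rewrite /aff intrN dotZr => /eqP; rewrite subr_eq0 => /eqP <-.
  by rewrite mulVKf.
have [n [h|h]] := root_comb (- k) bP.
  by rewrite h; apply: zero; rewrite -h.
by apply/eqP; rewrite -oppr_eq0 h zero // -h bu0 oppr0.
Qed.

(** A face lying in no facet of [Psi] has, for each upper wall with root in [Psi], a point off that
    wall, hence a point [p] off all of them. All strict coordinates are positive at [p], so it
    yields a pair in the open part that does not avoid. *)
Lemma avoids_compatible :
  (forall q w (x : {ffun 'I_l.+1 -> nat}), (0 < q)%N -> W w -> solutions q x ->
    in_open_part Phi alpha c Psi w x -> avoids Psi q (w (pt x))) ->
  compatible Phi alpha Psi.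
Proof.
move=> av A /(@is_alcoveP _ _ _ _ c)[w [g [Ww Zg ->]]] _ I J kI kJ pres D a m aPsi.
have DP y : D y <-> forall i, 0 <= wall w g i y /\ (w (bs i) \in pos -> 0 < wall w g i y).
  exact: partial_closureP.
apply: contrapT => /not_orP[ne no].
have {ne}[p0 Cp0] : (D `&` hyperplane a m) !=set0 by apply/set0P/eqP.
(* The strict indices are these together with the lower walls, whose coordinates are positive on all
   of [D]. *)
pose s := [seq i <- enum 'I_l.+1 | (w (bs i) \notin pos) && (- w (bs i) \in Psi)].
have [|x y [Dx xa] [Dy ya]|i x [/DP/(_ i)[]]//|i|p [Dp pa] ps] :=
  @common_positive (D `&` hyperplane a m) w g s.
- by exists p0.
- split; last first.
    rewrite /hyperplane /= dotDr dotZr dotBr.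
    by rewrite (_ : dot a x = m%:~R) // (_ : dot a y = m%:~R) // subrr mulr0 addr0.
  apply/DP => i; have [x0 x1] := (DP x).1 Dx i; have [y0 y1] := (DP y).1 Dy i.
  rewrite wall_segment; split=> [|wi]; first lra.
  by have := x1 wi; have := y1 wi; lra.
- rewrite mem_filter => /andP[/andP[wi wPsi] _].
  have [bJ wE] := upper_wall_presented Ww Zg pres wi.
  apply: contrapT => none; apply: no; exists (- w (bs i)), (kJ (- w (bs i))).
  split=> // [x [Dx xa]|].
    split=> //; apply/eqP; rewrite eq_sym -subr_eq0 -wE; apply/eqP/le_anti.
    have [-> _] := (DP x).1 Dx i; rewrite andbT leNgt; apply/negP => xi.
    by apply: none; exists x.
  split; last by right; exists (- w (bs i)).
  have [e ei ej] := wall_facet_center g i Ww; exists e; split.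
    apply/DP => j; have [->|ji] := eqVneq j i; first by rewrite ei (negbTE wi).
    by split=> [|_]; [apply/ltW|]; exact: ej.
  by apply/eqP; rewrite eq_sym -subr_eq0 -wE ei.
have [u pE] := weyl_affine_inv g p Ww.
have lamE i : wall w g i p = lam i u by rewrite pE wallE.
have u0 i : 0 <= lam i u by rewrite -lamE; have [] := (DP p).1 Dp i.
pose x : {ffun 'I_l.+1 -> nat} := [ffun i => nat_of_bool (0 < lam i u)].
(* The support of [u] fixes [x], and [q] is the value that makes [x] a solution; it is positive
   because the coordinates of [u] cannot all vanish. *)
pose q := (\sum_i ext_coef c i * x i)%N.
have q0 : (0 < q)%N.
  rewrite lt0n; apply/eqP => /eqP; rewrite sum_nat_eq0 => /forallP x0.
  have : \sum_i (ext_coef c i)%:R * lam i u = 0.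
    apply: big1 => i _; have := x0 i; rewrite muln_eq0 ffunE.
    rewrite eqn0Ngt ext_coef_gt0 /= eqb0 -leNgt => ui.
    by rewrite (_ : lam i u = 0) ?mulr0 //; apply/le_anti; rewrite ui u0.
  by rewrite sum_lam => /eqP; rewrite oner_eq0.
have op : in_open_part Phi alpha c Psi w x.
  apply/forallP => i; apply/implyP => st; rewrite ffunE lt0b -lamE.
  have [wi|wi] := boolP (w (bs i) \in pos); first by have [_] := (DP p).1 Dp i; exact.
  apply: ps; rewrite mem_filter mem_enum wi /= andbT.
  move: st; rewrite /strict in_fsetD pos_oppE ?wi ?andbT ?negbK //.
  exact: weyl_root Ww (bs_root i).
have aP : a \in Phi by exact: pos_root (fsubsetP Psi_pos _ aPsi).
have [v [Wv wv vw]] := weyl_inv Ww.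
have dotv y : dot a (w y) = dot (v a) y by rewrite -{1}(vw a) weyl_dot.
have [n gn] := coweight_int aP Zg.
apply: (av q w x q0 Ww erefl op a aPsi); exists (m - n).
rewrite dotv; apply: (support_divisible q0 (erefl : solutions q x) _ u0).
- exact: weyl_root Wv aP.
- by move=> i; rewrite ffunE.
- by rewrite -dotv intrB -gn -(_ : dot a p = m%:~R) // pE dotDr addrK.
Qed.

End Equivalence.

Theorem theorem4p11 (R : realType) (l : nat) (Phi : {fset 'rV[R]_l})
    (Phi_root : root_system Phi) (Phi_irr : irreducible_roots Phi)
    (alpha : 'I_l -> 'rV[R]_l) (alpha_simple : simple_system Phi alpha)
    (c : 'I_l -> nat) (c_highest : highest_root_coefs Phi alpha c)
    (Psi : {fset 'rV[R]_l}) (Psi_pos : (Psi `<=` positive_roots Phi alpha)%fset) :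
  compatible Phi alpha Psi <->
  (forall q : nat, (0 < q)%N ->
     ((chi_quasi alpha Psi q)%:R)%R
     = shift_op (eulerian Phi alpha c Psi) (ehrhart alpha c) q%:Z).
Proof.
have RD : root_data Phi alpha c by split=> //; case: Phi_irr.
apply: iff_trans (iff_sym (formula_iff Psi_pos)).
by split; [exact: compatible_avoids|exact: avoids_compatible].
Qed.
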